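(* Let $T$ be a torus acting on the smooth map $F\colon M\to N$ with a relative pre-$k$-plectic form $\varpi=(\omega,\eta)$ and relative moment map $\mu\in\Omega^{k-1}(F,\mathfrak t^* )$, and let $\phi\in\Omega^{k-1}(F,\mathfrak t^* )$ be a $T$-invariant $d_F$-closed level whose level pair $(L_N,L_M)$ consists of embedded submanifolds on which $T$ acts freely. Let $\kappa\in\Omega^{k-1}(F)$ be $T$-invariant and $d_F$-closed, $C\subseteq\mathfrak t^*$ open, $P=C\cdot\kappa+\phi=\{\lambda\cdot\kappa+\phi:\lambda\in C\}$, and assume the level pairs over $P$ form a trivialized family modeled on the level pair of $\phi$. Let $\psi$ be a direction of variation in the family (with $\phi+t\psi\in P$ for small $|t|$), and let $\widetilde\psi=(\widetilde\psi_N,\widetilde\psi_M)$ denote the $F_L$-pair of vector fields on the level family identified, under the trivialization, with the constant variation $\partial_\psi$ on the parameter factor. Then, with $\Phi^*=(i_N^*,i_M^* )$ and $\pi^*=(\pi_N^*,\pi_M^* )$, $$\pi^*\,\partial_\psi\varpi_\phi=d_{F_L}\,\Phi^*\bigl(\iota_{\widetilde\psi}\,\varpi\bigr),$$ componentwise $$\pi_N^*\partial_\psi\omega_\phi=d\,i_N^*\iota_{\widetilde\psi_N}\omega,\qquad \pi_M^*\partial_\psi\eta_\phi=F_L^*\,i_N^*\iota_{\widetilde\psi_N}\omega+d\,i_M^*\iota_{\widetilde\psi_M}\eta .$$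
   Context: All manifolds and maps are $C^\infty$; $\mathfrak t$ is the Lie algebra of $T$; forms of negative degree are zero. For smooth $F\colon M\to N$: $\Omega^j(F)=\Omega^j(N)\oplus\Omega^{j-1}(M)$, $d_F(\alpha,\beta)=(d\alpha,F^*\alpha-d\beta)$ (and similarly for $F_L$). An $F$-pair $v=(v_N,v_M)$ consists of $F$-related vector fields; $\iota_v(\alpha,\beta)=(\iota_{v_N}\alpha,-\iota_{v_M}\beta)$, $\mathcal L_v=(\mathcal L_{v_N},\mathcal L_{v_M})$. For $\lambda\in\mathfrak t^*$, $(\lambda\cdot\kappa)_\xi=\langle\lambda,\xi\rangle\kappa$. A relative pre-$k$-plectic form is a $d_F$-closed $\varpi\in\Omega^{k+1}(F)$. $T$ acts on $M$ and $N$ with $F$ equivariant, preserving $\varpi$; the relative moment map $\mu=(\mu_N,\mu_M)\in\Omega^{k-1}(F)\otimes\mathfrak t^*$ is equivariant with $d_F\mu_\xi=-\iota_{v_\xi}\varpi$ and $\mathcal L_{v_\xi}\mu_\zeta=\mu_{[\xi,\zeta]}$, where $v_\xi$ is the fundamental $F$-pair, $v_\xi|_x=\frac{d}{dt}|_0\exp(-t\xi)x$. Level pair at $\psi'$: $L_N(\psi')=\{y\in N:\mu_N(y)=\psi'_N(y)\}$ (equality in $\Lambda^{k-1}T_y^*N\otimes\mathfrak t^*$), $L_M(\psi')=F^{-1}(L_N(\psi'))\cap\{x\in M:\mu_M(x)=\psi'_M(x)\}$ (equality in $\Lambda^{k-2}T_x^*M\otimes\mathfrak t^*$). Write $L_N=L_N(\phi)$,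 $L_M=L_M(\phi)$, with inclusions $i_N,i_M$, $F_L\colon L_M\to L_N$ the restriction of $F$, quotient maps $\pi_N\colon L_N\to N_\phi=L_N/T$, $\pi_M\colon L_M\to M_\phi=L_M/T$, and induced map $F_\phi\colon M_\phi\to N_\phi$. The reduced form $\varpi_{\psi'}=(\omega_{\psi'},\eta_{\psi'})$ is the unique form on the reduced pair at $\psi'$ whose pullbacks to $L_N(\psi')$, $L_M(\psi')$ are the restrictions of $\omega,\eta$. Trivialized family: with $L_N(P)=\bigcup_{\psi'\in P}L_N(\psi')$, $L_M(P)=\bigcup_{\psi'\in P}L_M(\psi')$, there are $T$-equivariant diffeomorphisms $L_N(P)\cong L_N(\phi)\times C$, $L_M(P)\cong L_M(\phi)\times C$ over $C$, intertwining $F$ with $F_L\times\mathrm{id}_C$ and restricting to the identity on the level pair of $\phi$. Under it all reduced forms $\varpi_{\psi'}$, $\psi'\in P$, are regarded as forms on the fixed pair $F_\phi$, and $\partial_\psi\varpi_\phi:=\frac{d}{dt}\big|_{t=0}\varpi_{\phi+t\psi}\in\Omega^{k+1}(F_\phi)$. The vector fields $\widetilde\psi_N,\widetilde\psi_M$ are fields on $L_N(P)$, $L_M(P)$, and $i_N^*\iota_{\widetilde\psi_N}\omega$, $i_M^*\iota_{\widetilde\psi_M}\eta$ are the contractions along the level of $\phi$ pulled back to it. *)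

(* Defs.v *)
From HB Require Import structures.
From mathcomp Require Import all_boot all_order all_algebra.
From mathcomp Require Import all_classical all_reals all_analysis.
Set Implicit Arguments.
Unset Strict Implicit.
Unset Printing Implicit Defensive.
Import Order.TTheory GRing.Theory Num.Theory.
Import numFieldNormedType.Exports.
Local Open Scope classical_set_scope.
Local Open Scope ring_scope.

(** C^oo functions on an open set [U] of R^n: iterated directional derivatives
    of every order exist and are continuous on [U]. *)
Section SmoothEuclidean.
Variables (R : realType) (n : nat) (W : normedModType R).

Fixpoint Ck (k : nat) (U : set 'rV[R]_n) (f : 'rV[R]_n -> W) : Prop :=
  (forall x, U x -> {for x, continuous f}) /\
  match k with
  | 0%N => True
  | k'.+1 => forall v : 'rV[R]_n,
      (forall x, U x -> derivable f x v) /\ Ck k' U ('D_v f)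
  end.

Definition Cinf (U : set 'rV[R]_n) (f : 'rV[R]_n -> W) : Prop :=
  forall k, Ck k U f.

End SmoothEuclidean.

(** A chart is a homeomorphism from an open [cdom] onto an open [ctgt]; the
    values of [cmap] and [cinv] outside these sets are irrelevant. *)
Record chart (R : realType) (M : topologicalType) := Chart {
  cdim : nat;
  cdom : set M;
  ctgt : set 'rV[R]_cdim;
  cmap : M -> 'rV[R]_cdim;
  cinv : 'rV[R]_cdim -> M;
  cdom_open : open cdom;
  ctgt_open : open ctgt;
  cmap_tgt : forall x, cdom x -> ctgt (cmap x);
  cinv_dom : forall y, ctgt y -> cdom (cinv y);
  cmapK : forall x, cdom x -> cinv (cmap x) = x;
  cinvK : forall y, ctgt y -> cmap (cinv y) = y;
  cmap_cont : forall x, cdom x -> {for x, continuous cmap};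
  cinv_cont : forall y, ctgt y -> {for y, continuous cinv} }.
Arguments cdim {R M} c.
Arguments cdom {R M} c.
Arguments ctgt {R M} c.
Arguments cmap {R M} c.
Arguments cinv {R M} c.

Definition chart_compat (R : realType) (M : topologicalType)
    (c c' : chart R M) : Prop :=
  Cinf [set y | ctgt c y /\ cdom c' (cinv c y)] (cmap c' \o cinv c).

(** Smooth manifolds. The dimension is attached to charts, so that it may vary
    from one component to another; [chart_at] only selects, at each point, the
    coordinates in which tangent vectors are written. *)
Record manifold (R : realType) := Manifold {
  msort :> topologicalType;
  mhausdorff : hausdorff_space msort;
  mcountable : @second_countable msort;
  atlas : set (chart R msort);
  atlas_compat : forall c c', atlas c -> atlas c' -> chart_compat c c';
  chart_at : msort -> chart R msort;
  chart_at_atlas : forall x, atlas (chart_at x);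
  chart_at_dom : forall x, cdom (chart_at x) x }.
Arguments atlas {R} m.
Arguments chart_at {R m} x.

Section Euclid.
Variables (R : realType) (n : nat).

Lemma rV_second_countable : @second_countable 'rV[R]_n.
Proof.
pose B (p : 'rV[rat]_n * nat) : set 'rV[R]_n :=
  ball (map_mx ratr p.1 : 'rV[R]_n) (p.2.+1%:R^-1 : R).
exists (range B); first exact: sub_countable (card_image_le _ _) (countableP _).
split=> [_ [p _ <-]|x A].
  by apply: ball_open; rewrite invr_gt0 ltr0n.
rewrite -filter_from_ballE => -[e /= e0 eA].
have [m me] : exists m : nat, m.+1%:R^-1 < e / 2.
  near \oo => m; exists m; near: m.
  exact: (near_infty_natSinv_lt (PosNum (divr_gt0 e0 (ltr0n _ 2)))).
have m0 : 0 < m.+1%:R^-1 :> R by rewrite invr_gt0 ltr0n.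
have /choice[q qx] : forall j : 'I_n, exists q : rat,
    `|ratr q - x 0 j| < m.+1%:R^-1.
  move=> j; have /rat_in_itvoo[q] : x 0 j < x 0 j + m.+1%:R^-1 by rewrite ltrDl.
  rewrite in_itv /= => /andP[q1 q2]; exists q.
  by rewrite gtr0_norm ?subr_gt0// ltrBlDl.
have xB : B (\row_j q j, m) x.
  by split=> // i j; rewrite !mxE ord1; exact: qx.
exists (B (\row_j q j, m)); first by split=> //; exists (\row_j q j, m).
rewrite /= => y yB; apply: eA.
have le_ball' r r' (z w : 'rV[R]_n) : r < r' -> ball z r w -> ball z r' w.
  by move=> /ltW rr'; exact: le_ball.
apply: (@ball_splitr R 'rV[R]_n (map_mx ratr (\row_j q j))).
  exact: le_ball' me xB.
exact: le_ball' me yB.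
Unshelve. all: by end_near. Qed.

Lemma id_cont (x : 'rV[R]_n) :
  (fun _ => True) x -> {for x, continuous (id : 'rV[R]_n -> 'rV[R]_n)}.
Proof. by move=> _; exact: cvg_id. Qed.

Definition id_chart : chart R 'rV[R]_n :=
  @Chart R 'rV[R]_n n setT setT id id openT openT
    (fun=> id) (fun=> id) (fun x _ => erefl) (fun x _ => erefl)
    id_cont id_cont.

Lemma Ck_cst (k : nat) (U : set 'rV[R]_n) m (w : 'rV[R]_m) :
  Ck k U (fun=> w).
Proof.
elim: k w => [|k ih] w /=; split=> //; try by move=> x _; exact: cst_continuous.
move=> v; split=> [x _|]; first exact: derivable_cst.
by rewrite (_ : 'D_v _ = fun=> 0)//; apply/funext => x; rewrite derive_cst.
Qed.

Lemma Cinf_id (U : set 'rV[R]_n) : Cinf U (id : 'rV[R]_n -> 'rV[R]_n).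
Proof.
have ci x : U x -> {for x, continuous (id : 'rV[R]_n -> 'rV[R]_n)}.
  by move=> _; exact: cvg_id.
case=> [|k] /=; split=> //; move=> v; split=> [x _|]; first exact: derivable_id.
rewrite (_ : 'D_v _ = fun=> v); first exact: Ck_cst.
by apply/funext => x; rewrite derive_id.
Qed.

Lemma euclid_compat (c c' : chart R 'rV[R]_n) :
  [set id_chart] c -> [set id_chart] c' -> chart_compat c c'.
Proof. by move=> -> ->; exact: Cinf_id. Qed.

Definition euclid : manifold R :=
  @Manifold R 'rV[R]_n (@norm_hausdorff R 'rV[R]_n) rV_second_countable
    [set id_chart] euclid_compat (fun=> id_chart) (fun=> erefl (id_chart : chart R 'rV[R]_n)) (fun _ => I).

End Euclid.

Section Product.
Variable R : realType.

Lemma prod_hausdorff (A B : topologicalType) :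
  hausdorff_space A -> hausdorff_space B -> hausdorff_space (A * B)%type.
Proof.
move=> hA hB [a b] [a' b'] h; congr pair.
- apply: hA => P Q aP bQ.
  have [||[p q] [[/= ? _] [/= ? _]]] := h (P `*` setT) (Q `*` setT).
  + by exists (P, setT) => //; split => //; exact: filterT.
  + by exists (Q, setT) => //; split => //; exact: filterT.
  by exists p.
- apply: hB => P Q aP bQ.
  have [||[p q] [[/= _ ?] [/= _ ?]]] := h (setT `*` P) (setT `*` Q).
  + by exists (setT, P) => //; split => //; exact: filterT.
  + by exists (setT, Q) => //; split => //; exact: filterT.
  by exists q.
Qed.

Lemma prod_open (A B : topologicalType) (U : set A) (V : set B) :
  open U -> open V -> open (U `*` V).
Proof.
rewrite !openE => oU oV [a b] [/= /oU Ua /oV Vb].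
by exists (U, V).
Qed.

Lemma prod_second_countable (A B : topologicalType) :
  @second_countable A -> @second_countable B ->
  @second_countable (A * B)%type.
Proof.
move=> [BA cA [oA bA]] [BB cB [oB bB]].
exists ((fun p => p.1 `*` p.2) @` (BA `*` BB)).
  exact: sub_countable (card_image_le _ _) (countableX cA cB).
split=> [_ [[U V] [/= BU BV] <-]|[a b] W].
  by apply: prod_open; [exact: oA|exact: oB].
move=> [[P Q] [/= aP bQ] PQW].
have [U [BU Ua] UP] := bA a P aP.
have [V [BV Vb] VQ] := bB b Q bQ.
exists (U `*` V); first by split=> //; exists (U, V).
by move=> [x y] [/= Ux Vy]; apply: PQW; split=> /=; [exact: UP|exact: VQ].
Qed.

Lemma cvg_row_mx (T : Type) (F : set_system T) {FF : Filter F} m n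
    (f : T -> 'rV[R]_m) (g : T -> 'rV[R]_n)
    (u : 'rV[R]_m) (v : 'rV[R]_n) :
  f @ F --> u -> g @ F --> v ->
  (fun z => row_mx (f z) (g z)) @ F --> row_mx u v.
Proof.
move=> cf cg P /nbhs_ballP[e /= e0 eP].
have := cf _ (nbhsx_ballx u e e0); have := cg _ (nbhsx_ballx v e e0).
rewrite !nbhs_filterE /=; apply: filterS2 => z; move=> [_ gz] [_ fz].
apply: eP; split=> // i j; rewrite !mxE.
by case: splitP => k _; [exact: fz|exact: gz].
Qed.

Lemma row_mx_cont (A : topologicalType) m n (f : A -> 'rV[R]_m)
    (g : A -> 'rV[R]_n) x :
  {for x, continuous f} -> {for x, continuous g} ->
  {for x, continuous (fun z => row_mx (f z) (g z))}.
Proof. by move=> cf cg; exact: cvg_row_mx cf cg. Qed.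

Section ProdChart.
Variables (A B : topologicalType) (a : chart R A) (b : chart R B).

Let pdom := cdom a `*` cdom b.
Let ptgt : set 'rV[R]_(cdim a + cdim b) :=
  lsubmx @^-1` ctgt a `&` rsubmx @^-1` ctgt b.
Let pmap (p : A * B) := row_mx (cmap a p.1) (cmap b p.2).
Let pinv (z : 'rV[R]_(cdim a + cdim b)) := (cinv a (lsubmx z), cinv b (rsubmx z)).

Lemma pdom_open : open pdom.
Proof. by apply: prod_open; exact: cdom_open. Qed.

Lemma ptgt_open : open ptgt.
Proof.
apply: openI; apply: open_comp; try exact: ctgt_open.
- by move=> z _; exact: continuous_lsubmx.
- by move=> z _; exact: continuous_rsubmx.
Qed.

Lemma pmap_tgt p : pdom p -> ptgt (pmap p).
Proof.
by move=> [? ?]; split; rewrite /= ?row_mxKl ?row_mxKr; exact: cmap_tgt.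
Qed.

Lemma pinv_dom z : ptgt z -> pdom (pinv z).
Proof. by move=> [? ?]; split; exact: cinv_dom. Qed.

Lemma pmapK p : pdom p -> pinv (pmap p) = p.
Proof.
by case: p => x y [/= ? ?]; rewrite /pinv /pmap row_mxKl row_mxKr !cmapK.
Qed.

Lemma pinvK z : ptgt z -> pmap (pinv z) = z.
Proof. by move=> [? ?]; rewrite /pmap /= !cinvK// hsubmxK. Qed.

Lemma pmap_cont p : pdom p -> {for p, continuous pmap}.
Proof.
move=> [? ?]; apply: row_mx_cont.
- by apply: (@continuous_comp _ _ _ fst); [exact: cvg_fst|exact: cmap_cont].
- by apply: (@continuous_comp _ _ _ snd); [exact: cvg_snd|exact: cmap_cont].
Qed.

Lemma pinv_cont z : ptgt z -> {for z, continuous pinv}.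
Proof.
move=> [za zb].
have ca : {for z, continuous (cinv a \o lsubmx)}.
  apply: continuous_comp; first exact: continuous_lsubmx.
  exact: cinv_cont.
have cb : {for z, continuous (cinv b \o rsubmx)}.
  apply: continuous_comp; first exact: continuous_rsubmx.
  exact: cinv_cont.
exact: (cvg_pair ca cb).
Qed.

Definition prod_chart : chart R (A * B)%type :=
  @Chart R (A * B)%type (cdim a + cdim b) pdom ptgt pmap pinv
    pdom_open ptgt_open pmap_tgt pinv_dom pmapK pinvK pmap_cont pinv_cont.

End ProdChart.

Lemma Ck_ext n (W : normedModType R) k (U : set 'rV[R]_n)
    (f g : 'rV[R]_n -> W) :
  open U -> (forall x, U x -> f x = g x) -> Ck k U f -> Ck k U g.
Proof.
move=> oU; elim: k f g => [|k ih] f g fg [cf df];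
    have fgn : forall x, U x -> {near x, f =1 g} by
      [move=> x Ux; near=> z; apply: fg; near: z; exact: open_nbhs_nbhs];
    have cg : forall x, U x -> {for x, continuous g} by
      [move=> x Ux; have := cf x Ux; rewrite /prop_for /continuous_at (fg x Ux);
       exact: (cvg_trans (near_eq_cvg (fgn x Ux)))].
  by split.
split=> // v.
have [dfv ckf] := df v; split=> [x Ux|].
  exact: (near_eq_derivable (fgn x Ux) (dfv x Ux)).
apply: ih ckf => x Ux; apply: near_eq_derive; exact: fgn.
Unshelve. all: by end_near. Qed.

Lemma Ck_row m n p q (U : set 'rV[R]_m) (V : set 'rV[R]_n)
    (f : 'rV[R]_m -> 'rV[R]_p) (g : 'rV[R]_n -> 'rV[R]_q) k :
  open U -> open V -> Ck k U f -> Ck k V g ->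
  Ck k (lsubmx @^-1` U `&` rsubmx @^-1` V)
    (fun z => row_mx (f (lsubmx z)) (g (rsubmx z))).
Proof.
move=> oU oV.
have oUV : open (lsubmx @^-1` U `&` rsubmx @^-1` V : set 'rV[R]_(m + n)).
  apply: openI; apply: open_comp => // z _.
  - exact: continuous_lsubmx.
  - exact: continuous_rsubmx.
have cnt (f' : 'rV[R]_m -> 'rV[R]_p) (g' : 'rV[R]_n -> 'rV[R]_q) z :
    {for lsubmx z, continuous f'} -> {for rsubmx z, continuous g'} ->
    {for z, continuous (fun z => row_mx (f' (lsubmx z)) (g' (rsubmx z)))}.
  move=> cf cg.
  have cfl : {for z, continuous (f' \o lsubmx)}.
    by apply: continuous_comp; [exact: continuous_lsubmx|exact: cf].
  have cgr : {for z, continuous (g' \o rsubmx)}.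
    by apply: continuous_comp; [exact: continuous_rsubmx|exact: cg].
  exact: (row_mx_cont cfl cgr).
elim: k f g => [|k ih] f g [cf df] [cg dg].
  by split=> // z [Uz Vz]; apply: cnt; [exact: cf|exact: cg].
split=> [z [Uz Vz]|v]; first by apply: cnt; [exact: cf|exact: cg].
have [dfv kf] := df (lsubmx v); have [dgv kg] := dg (rsubmx v).
have key z : (lsubmx @^-1` U `&` rsubmx @^-1` V) z ->
    (fun h : R => h^-1 *: (row_mx (f (lsubmx (h *: v + z))) (g (rsubmx (h *: v + z)))
       - row_mx (f (lsubmx z)) (g (rsubmx z)))) @ 0^' -->
    row_mx ('D_(lsubmx v) f (lsubmx z)) ('D_(rsubmx v) g (rsubmx z)).
  move=> [Uz Vz].
  rewrite [X in X @ _ --> _](_ : _ = fun h : R => row_mx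
      (h^-1 *: ((f \o shift (lsubmx z)) (h *: lsubmx v) - f (lsubmx z)))
      (h^-1 *: ((g \o shift (rsubmx z)) (h *: rsubmx v) - g (rsubmx z)))).
    by apply: cvg_row_mx; [exact: dfv|exact: dgv].
  apply/funext => h.
  by rewrite opp_row_mx add_row_mx scale_row_mx /= !linearP.
split=> [z UVz|].
  by apply/cvg_ex; eexists; exact: key UVz.
apply: Ck_ext (ih _ _ kf kg) => // z UVz.
by apply/esym/cvg_lim; [exact: norm_hausdorff|exact: key UVz].
Qed.

Lemma trans_open (M : topologicalType) (c c' : chart R M) :
  open [set y | ctgt c y /\ cdom c' (cinv c y)].
Proof.
rewrite openE => y [cy c'y].
have ny : nbhs y (ctgt c) by apply: open_nbhs_nbhs; split=> //; exact: ctgt_open.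
have nc : nbhs (cinv c y) (cdom c').
  by apply: open_nbhs_nbhs; split=> //; exact: cdom_open.
exact: filterI ny (cinv_cont cy nc).
Qed.

Definition prod_atlas (A B : manifold R) : set (chart R (A * B)%type) :=
  [set c | exists a b, [/\ atlas A a, atlas B b & c = prod_chart a b]].

Lemma prod_compat (A B : manifold R) (c c' : chart R (A * B)%type) :
  prod_atlas c -> prod_atlas c' -> chart_compat c c'.
Proof.
move=> [a [b [Aa Bb ->]]] [a' [b' [Aa' Bb' ->]]] k.
have h := Ck_row (@trans_open _ a a') (@trans_open _ b b')
  (atlas_compat Aa Aa' k) (atlas_compat Bb Bb' k).
rewrite (_ : [set y | _] = lsubmx @^-1` [set y | ctgt a y /\ cdom a' (cinv a y)]
  `&` rsubmx @^-1` [set y | ctgt b y /\ cdom b' (cinv b y)]); first exact: h.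
by apply/seteqP; split=> z /= [[? ?] [? ?]].
Qed.

Lemma prod_chart_atlas (A B : manifold R) (p : A * B) :
  prod_atlas (prod_chart (chart_at p.1) (chart_at p.2)).
Proof. by exists (chart_at p.1), (chart_at p.2); split=> //; exact: chart_at_atlas. Qed.

Lemma prod_chart_dom (A B : manifold R) (p : A * B) :
  cdom (prod_chart (chart_at p.1) (chart_at p.2)) p.
Proof. by split; exact: chart_at_dom. Qed.

Definition prodM (A B : manifold R) : manifold R :=
  @Manifold R (A * B)%type
    (prod_hausdorff (@mhausdorff R A) (@mhausdorff R B))
    (prod_second_countable (@mcountable R A) (@mcountable R B))
    (@prod_atlas A B) (@prod_compat A B)
    (fun p => prod_chart (chart_at p.1) (chart_at p.2))
    (@prod_chart_atlas A B) (@prod_chart_dom A B).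

End Product.

(** Tangent vectors at [x] are written in the coordinates [chart_at x]. *)
Definition tangent (R : realType) (M : manifold R) (x : M) : Type :=
  'rV[R]_(cdim (chart_at x)).

Definition vfield (R : realType) (M : manifold R) : Type :=
  forall x : M, tangent x.

Section Maps.
Variables (R : realType) (A B : manifold R).

Definition smooth_on (U : set A) (f : A -> B) : Prop :=
  (forall x, U x -> {for x, continuous f}) /\
  forall (a : chart R A) (b : chart R B), atlas A a -> atlas B b ->
    Cinf [set y | [/\ ctgt a y, U (cinv a y) & cdom b (f (cinv a y))]]
         (fun y => cmap b (f (cinv a y))).

Definition smooth (f : A -> B) : Prop := smooth_on setT f.

Definition dif (f : A -> B) (x : A) (v : tangent x) : tangent (f x) :=
  'D_v (fun y => cmap (chart_at (f x)) (f (cinv (chart_at x) y)))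
    (cmap (chart_at x) x).

Definition immersed (f : A -> B) : Prop :=
  [/\ smooth f, injective f & forall x, injective (@dif f x)].

Definition embedded (f : A -> B) : Prop :=
  immersed f /\
  forall U : set A, open U -> exists2 V : set B, open V & U = f @^-1` V.

Definition surjective_submersion (f : A -> B) : Prop :=
  [/\ smooth f, forall b, exists a, f a = b &
      forall x (w : tangent (f x)), exists v : tangent x, dif f v = w].

End Maps.

(** Differential forms. A field of forms takes a point and a list of tangent
    vectors; a form of degree [j] vanishes on lists whose length is not [j], so
    that forms of negative degree are zero. *)
Definition rawform (R : realType) (M : manifold R) : Type :=
  forall x : M, seq (tangent x) -> R.

Section Forms.
Variables (R : realType) (M : manifold R).
Implicit Types (al be : rawform M).

Definition fzero : rawform M := fun _ _ => 0.
Definition fadd al be : rawform M := fun x s => al x s + be x s.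
Definition fopp al : rawform M := fun x s => - al x s.
Definition fscale (c : R) al : rawform M := fun x s => c * al x s.

Definition dcinv (c : chart R M) (y w : 'rV[R]_(cdim c)) :
    tangent (cinv c y) :=
  'D_w (fun z => cmap (chart_at (cinv c y)) (cinv c z)) y.

(** Expression of a form in the coordinates of the chart [c]. *)
Definition in_chart (c : chart R M) al
    (y : 'rV[R]_(cdim c)) (s : seq 'rV[R]_(cdim c)) : R :=
  al (cinv c y) [seq dcinv y w | w <- s].

Definition is_form (j : int) al : Prop :=
  [/\ forall x s, (size s)%:Z != j -> al x s = 0,
      forall x (s1 s2 : seq (tangent x)) (c : R) (u v : 'rV[R]_(cdim (chart_at x))),
        al x (s1 ++ (c *: u + v) :: s2) =
          c * al x (s1 ++ u :: s2) + al x (s1 ++ v :: s2),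
      forall x (s1 s2 s3 : seq (tangent x)) (u : tangent x),
        al x (s1 ++ u :: s2 ++ u :: s3) = 0 &
      forall (c : chart R M) (s : seq 'rV[R]_(cdim c)), atlas M c ->
        Cinf (ctgt c) (fun y => in_chart al y s : R^o)].

(** (d al)(s_0, .., s_j) = \sum_i (-1)^i D_{s_i} al(s_0, .., s_j without s_i),
    computed in the chart at the point. *)
Definition extd al : rawform M := fun x s =>
  \sum_(i < size s) (-1) ^+ i *
    'D_(nth (0 : 'rV[R]_(cdim (chart_at x))) s i)
      (fun y => in_chart al y (take i s ++ drop i.+1 s) : R^o)
      (cmap (chart_at x) x).

Definition iprod (v : vfield M) al : rawform M := fun x s => al x (v x :: s).

End Forms.
Arguments fzero {R M}.

Definition pull (R : realType) (A B : manifold R) (f : A -> B)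
    (al : rawform B) : rawform A :=
  fun x s => al (f x) [seq dif f v | v <- s].

(** Derivative at time 0 of the curve [c] through [x = c 0]. *)
Definition velocity (R : realType) (M : manifold R) (c : R -> M) (x : M) :
    tangent x :=
  derive1 (fun t : R => cmap (chart_at x) (c t)) 0.

Definition fderiv (R : realType) (M : manifold R) (w : R -> rawform M) :
    rawform M :=
  fun x s => derive1 (fun t : R => w t x s : R^o) 0.

(** Lie derivative along the vector field with flow [fl]. *)
Definition lie (R : realType) (M : manifold R) (fl : R -> M -> M)
    (al : rawform M) : rawform M := fderiv (fun t => pull (fl t) al).

(** Relative forms of F : M -> N: pairs of a form on N and a form on M. *)
Definition rform (R : realType) (M N : manifold R) : Type :=
  (rawform N * rawform M)%type.

Section Relative.
Variables (R : realType) (M N : manifold R).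
Implicit Types th : rform M N.

Definition is_rform (j : int) th : Prop := is_form j th.1 /\ is_form (j - 1) th.2.
Definition rzero : rform M N := (fzero, fzero).
Definition radd th th' : rform M N := (fadd th.1 th'.1, fadd th.2 th'.2).
Definition rscale (c : R) th : rform M N := (fscale c th.1, fscale c th.2).
Definition ropp th : rform M N := (fopp th.1, fopp th.2).

Definition dF (F : M -> N) th : rform M N :=
  (extd th.1, fadd (pull F th.1) (fopp (extd th.2))).

Definition riprod (vN : vfield N) (vM : vfield M) th : rform M N :=
  (iprod vN th.1, fopp (iprod vM th.2)).

Definition rlie (flN : R -> N -> N) (flM : R -> M -> M) th : rform M N :=
  (lie flN th.1, lie flM th.2).

Definition rderiv (w : R -> rform M N) : rform M N :=
  (fderiv (fun t => (w t).1), fderiv (fun t => (w t).2)).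

End Relative.
Arguments rzero {R M N}.

Definition rpull (R : realType) (M N M' N' : manifold R)
    (fN : N' -> N) (fM : M' -> M) (th : rform M N) : rform M' N' :=
  (pull fN th.1, pull fM th.2).

(** A torus is a commutative Lie group presented as R^r / Z^r; its Lie algebra
    is then R^r, with zero bracket, and [texp] is the exponential map. *)
Record torus (R : realType) := Torus {
  trank : nat;
  tman :> manifold R;
  tmul : tman -> tman -> tman;
  tone : tman;
  tinv : tman -> tman;
  tmulA : forall g h k, tmul g (tmul h k) = tmul (tmul g h) k;
  tmulC : forall g h, tmul g h = tmul h g;
  tmul1 : forall g, tmul tone g = g;
  tmulV : forall g, tmul (tinv g) g = tone;
  tmul_smooth : smooth (fun p : prodM tman tman => tmul p.1 p.2);
  tinv_smooth : smooth tinv;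
  texp : 'rV[R]_trank -> tman;
  texp_smooth : @smooth R (euclid R trank) tman texp;
  texpD : forall x y, texp (x + y) = tmul (texp x) (texp y);
  texp_surj : forall g, exists x, texp x = g;
  texp_ker : forall x, texp x = tone <-> forall i, x 0 i \is a Num.int;
  texp_section : forall g, exists U : set tman, [/\ open U, U g &
    exists2 s : tman -> 'rV[R]_trank, @smooth_on R tman (euclid R trank) U s &
      forall h, U h -> texp (s h) = h] }.
Arguments trank {R} t.
Arguments tmul {R t} g h.
Arguments tone {R t}.
Arguments texp {R t} x.

Definition tbracket (R : realType) (T : torus R) (xi zeta : 'rV[R]_(trank T)) :
  'rV[R]_(trank T) := 0.

(** Pairing of R^r (the dual of the Lie algebra) with R^r (the Lie algebra). *)
Definition tdual (R : realType) (T : torus R) (lam xi : 'rV[R]_(trank T)) : R :=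
  \sum_i lam 0 i * xi 0 i.

Section Actions.
Variables (R : realType) (T : torus R).

Definition is_action (M : manifold R) (a : T -> M -> M) : Prop :=
  [/\ smooth (fun p : prodM T M => a p.1 p.2),
      forall x, a tone x = x &
      forall g h x, a (tmul g h) x = a g (a h x)].

(** The flow exp(-t xi) of the fundamental vector field of [xi]. *)
Definition fund_flow (M : manifold R) (a : T -> M -> M)
    (xi : 'rV[R]_(trank T)) (t : R) (x : M) : M := a (texp (- (t *: xi))) x.

Definition fund (M : manifold R) (a : T -> M -> M) (xi : 'rV[R]_(trank T)) :
    vfield M := fun x => velocity (fun t => fund_flow a xi t x) x.

Variables (M N : manifold R).

Definition trform : Type := 'rV[R]_(trank T) -> rform M N.
Implicit Types th : trform.

Definition is_trform (j : int) th : Prop :=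
  (forall xi, is_rform j (th xi)) /\
  (forall (c : R) xi zeta,
     th (c *: xi + zeta) = radd (rscale c (th xi)) (th zeta)).

Definition tadd th th' : trform := fun xi => radd (th xi) (th' xi).
Definition tscale (c : R) th : trform := fun xi => rscale c (th xi).

(** (lam . kappa)_xi = <lam, xi> kappa *)
Definition tdot (lam : 'rV[R]_(trank T)) (kappa : rform M N) : trform :=
  fun xi => rscale (tdual lam xi) kappa.

Definition level_family (C : set 'rV[R]_(trank T)) (kappa : rform M N)
    (phi : trform) : set trform :=
  [set th | exists2 lam, C lam & th = tadd (tdot lam kappa) phi].

Variables (F : M -> N) (aN : T -> N -> N) (aM : T -> M -> M).

Definition rinvariant (th : rform M N) : Prop :=
  forall g, rpull (aN g) (aM g) th = th.

Definition pre_plectic (k : nat) (varpi : rform M N) : Prop :=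
  is_rform (k%:Z + 1) varpi /\ dF F varpi = rzero.

(** [T] being commutative, its coadjoint action is trivial and equivariance of
    [mu] means that every component [mu xi] is invariant. *)
Definition moment_map (k : nat) (varpi : rform M N) (mu : trform) : Prop :=
  [/\ is_trform (k%:Z - 1) mu,
      forall xi, rinvariant (mu xi),
      forall xi, dF F (mu xi) = ropp (riprod (fund aN xi) (fund aM xi) varpi) &
      forall xi zeta, rlie (fund_flow aN xi) (fund_flow aM xi) (mu zeta) =
        mu (tbracket xi zeta)].

Definition levelN (mu th : trform) : set N :=
  [set y | forall xi, (mu xi).1 y = (th xi).1 y].

Definition levelM (mu th : trform) : set M :=
  [set x | levelN mu th (F x) /\ forall xi, (mu xi).2 x = (th xi).2 x].

(** A level pair as a pair of manifolds with inclusions, together with its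
    quotient by [T]. *)
Record level_pair := LevelPair {
  lvN : manifold R;
  lvM : manifold R;
  inN : lvN -> N;
  inM : lvM -> M;
  lvF : lvM -> lvN;
  redN : manifold R;
  redM : manifold R;
  prN : lvN -> redN;
  prM : lvM -> redM;
  redF : redM -> redN }.
Arguments inN l _ : clear implicits.
Arguments inM l _ : clear implicits.
Arguments lvF l _ : clear implicits.
Arguments prN l _ : clear implicits.
Arguments prM l _ : clear implicits.
Arguments redF l _ : clear implicits.

Definition free_on (X : manifold R) (a : T -> X -> X) (L : manifold R)
    (i : L -> X) : Prop :=
  forall g y, a g (i y) = i y -> g = tone.

(** [p : L -> Q] is the quotient of [L] (included in [X] by [i]) by [T]. *)
Definition orbit_quotient (X : manifold R) (a : T -> X -> X) (L Q : manifold R)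
    (i : L -> X) (p : L -> Q) : Prop :=
  surjective_submersion p /\
  forall y y', p y = p y' <-> exists g, i y' = a g (i y).

Definition is_level_pair (mu th : trform) (L : level_pair) : Prop :=
  [/\ [/\ embedded (inN L), range (inN L) = levelN mu th,
          embedded (inM L) & range (inM L) = levelM mu th],
      forall x : lvM L, inN L (lvF L x) = F (inM L x),
      free_on aN (inN L) /\ free_on aM (inM L),
      orbit_quotient aN (inN L) (prN L) /\
        orbit_quotient aM (inM L) (prM L) &
      forall x : lvM L, redF L (prM L x) = prN L (lvF L x)].

(** [red] is the form induced by [varpi] on the quotient pair. *)
Definition is_reduced (k : nat) (varpi : rform M N) (L : level_pair)
    (red : rform (redM L) (redN L)) : Prop :=
  is_rform (k%:Z + 1) red /\
  rpull (prN L) (prM L) red = rpull (inN L) (inM L) varpi.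

End Actions.
Arguments inN {R M N} l _.
Arguments inM {R M N} l _.
Arguments lvF {R M N} l _.
Arguments prN {R M N} l _.
Arguments prM {R M N} l _.
Arguments redF {R M N} l _.

(** A trivialization over [C] of the union [Fam] of the levels [lev lam]
    of [X], modeled on the level [L]: [i], [j] are the inclusions of [L] and
    [Fam] into [X] and [e] that of [L] into [Fam]; the trivialization
    [Th : L * C -> Fam] is defined on an open subset of L * R^r. That [Th] is
    over [C] means that the levels are the fibres of the C-component of its
    inverse; equivariance is stated in [X], where [T] acts. *)
Record trivialization (R : realType) (T : torus R) (X L : manifold R) :=
    Trivialization {
  fam : manifold R;
  fin : fam -> X;
  fbase : L -> fam;
  ftriv : prodM L (euclid R (trank T)) -> fam;
  ftrivV : fam -> prodM L (euclid R (trank T)) }.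

Arguments fin {R T X L} t _.
Arguments fbase {R T X L} t _.
Arguments ftriv {R T X L} t _.
Arguments ftrivV {R T X L} t _.

Section Trivialization.
Variables (R : realType) (T : torus R) (X L : manifold R).

Definition is_trivialization (a : T -> X -> X) (i : L -> X)
    (C : set 'rV[R]_(trank T)) (lev : 'rV[R]_(trank T) -> set X)
    (base : set 'rV[R]_(trank T)) (Th : trivialization T X L) : Prop :=
  [/\ [/\ immersed (fin Th),
          range (fin Th) = \bigcup_(lam in C) lev lam &
          forall y, fin Th (fbase Th y) = i y],
      [/\ @smooth_on R (prodM L (euclid R (trank T))) (fam Th)
          [set p | C p.2] (ftriv Th),
          @smooth R (fam Th) (prodM L (euclid R (trank T))) (ftrivV Th),
          forall z : fam Th, C (ftrivV Th z).2,
          forall z : fam Th, ftriv Th (ftrivV Th z) = z &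
          forall y lam, C lam -> ftrivV Th (ftriv Th (y, lam)) = (y, lam)],
      forall (z : fam Th) lam, C lam -> (lev lam (fin Th z) <-> (ftrivV Th z).2 = lam),
      forall g y y' lam, C lam -> i y' = a g (i y) ->
        fin Th (ftriv Th (y', lam)) = a g (fin Th (ftriv Th (y, lam))) &
      forall y lam, C lam -> base lam -> ftriv Th (y, lam) = fbase Th y].

(** [bar : Q -> Q'] is induced on the quotients [p : L -> Q], [p' : L' -> Q']
    by the slice at [lam] of the trivialization, where [i'] is the inclusion
    into [X] of the level [L'] of parameter [lam]. *)
Definition induced_on_quotients (Th : trivialization T X L)
    (lam : 'rV[R]_(trank T)) (L' Q Q' : manifold R) (i' : L' -> X)
    (p : L -> Q) (p' : L' -> Q') (bar : Q -> Q') : Prop :=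
  forall (y : L) (y' : L'), i' y' = fin Th (ftriv Th (y, lam)) ->
    bar (p y) = p' y'.

(** The vector field [v] corresponds to the constant field [lam] on the
    parameter factor. *)
Definition constant_variation (C : set 'rV[R]_(trank T))
    (Th : trivialization T X L) (lam : 'rV[R]_(trank T))
    (v : vfield (fam Th)) : Prop :=
  forall (y : L) (c : euclid R (trank T)), C c ->
    @dif R (prodM L (euclid R (trank T))) (fam Th) (ftriv Th) (y, c)
      (row_mx (0 : 'rV[R]_(cdim (chart_at y))) lam)
    = v (ftriv Th (y, c)).

End Trivialization.

(* Main.v *)
(** On the product of the base level with the parameter space, the inclusions of
    the levels are the slices of one map [j] into the ambient manifold.  Pulled
    back to the base level, the reduced form at parameter [l] becomes the pullback
    of the ambient form along the slice [j (., l)], so its derivative along [dir] is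
    given by Cartan's formula: [d i_v + i_v d] applied to the pullback of the
    ambient form along [j], where [v] is the constant field [dir] on the parameter
    factor.  Closedness for [d_F] says [d omega = 0] and [d eta = F^* omega]; hence
    the second term vanishes on [N], and on [M] it is the pullback of
    [i_v omega] along [F], since [F] intertwines the two trivializations.
    No inverse function theorem is needed for the induced maps: lifting
    through an immersion and descending along a submersion preserve pointwise
    differentiability, which is all that the chain rule for pullbacks uses. *)

From HB Require Import structures.
Require Import Defs.
From mathcomp Require Import all_boot all_order all_algebra.
From mathcomp Require Import all_classical all_reals all_analysis.
From mathcomp Require Import ring lra.
Set Implicit Arguments.
Unset Strict Implicit.
Unset Printing Implicit Defensive.
Import Order.TTheory GRing.Theory Num.Theory.
Import numFieldNormedType.Exports.
Local Open Scope classical_set_scope.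
Local Open Scope ring_scope.

(** * Calculus in R^n *)

(** Pullback along [prN] and [prM] evaluates the reduced forms on tangent vectors that do not depend
    on [t], so it commutes with the time derivative by definition, and only the germ at [t = 0] of
    the pulled-back curve of forms matters. The work lies in the calculus behind Cartan's formula on
    the product and in its transport by [total_map]. The first obstacle is that a form at a point is
    written in the chart selected at that point, and [extd] is computed there. Naturality of [extd]
    must therefore cross charts; it rests on the symmetry of second derivatives. A chart inverse is
    treated as a map from a Euclidean manifold, which turns passing to coordinates into one more
    pullback. The second obstacle is that the induced maps [barN], [barM] come as bare functions.
    Their differentiability is extracted from strict differentiability of the projections, an
    estimate uniform in two moving points, from which a contraction argument produces preimages with
    linear bounds. *)

Section Differentiability.
Variables (R : realType) (V W : normedModType R).
Implicit Types f g : V -> W.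

Lemma diff_approx f x : differentiable f x -> forall e : R, 0 < e ->
  \forall y \near x, `|f y - f x - 'd f x (y - x)| <= e * `|y - x|.
Proof.
move=> df e e0; have /eqaddoP/(_ e e0) := diff_locally df.
rewrite near_simpl (near_shift x 0) /=; apply: filterS => y /=.
by rewrite sub0r !fctE /= subrK opprD addrA.
Qed.

(** This is how differentiability is proved from estimates below, with an explicit candidate [l] for
    the derivative. *)
Lemma approx_diff f x (l : {linear V -> W}) : continuous l ->
  (forall e : R, 0 < e ->
    \forall y \near x, `|f y - f x - l (y - x)| <= e * `|y - x|) ->
  differentiable f x /\ 'd f x = l :> (V -> W).
Proof.
move=> cl h.
have E : f \o shift x = cst (f x) + l +o_ (0 : V) id.
  apply/eqaddoP => e e0.
  have := h e e0; rewrite (near_shift 0 x).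
  by apply: filterS => z; rewrite /= subr0 addrK !fctE /= opprD addrA.
have := diff_unique cl E; move=> dl; split=> //.
by apply/diff_locallyP; rewrite dl.
Qed.

Lemma near_eq_differentiable f g x : (\near x, f x = g x) ->
  differentiable f x -> differentiable g x.
Proof.
move=> fg df; have fgx := nbhs_singleton fg.
have [] // := @approx_diff g x ('d f x) (diff_continuous df).
move=> e e0; have := diff_approx df e0; apply: filter_app.
by move: fg; apply: filterS => y -> ; rewrite fgx.
Qed.

Lemma derive_shiftE f x v : 'D_v f x = derive1 (fun t : R => f (t *: v + x)) 0.
Proof.
rewrite /derive1 /derive; apply: (congr1 (fun F => lim (F @ 0^'))); apply/funext => h /=.
by rewrite addr0 scale0r add0r.
Qed.

Lemma derivable_line f z v (t : R) :
  derivable f (z + t *: v) v <-> derivable (fun s : R => f (z + s *: v)) t 1.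
Proof.
rewrite /derivable; set g1 := fun h => _; set g2 := fun h => _.
suff -> : g1 = g2 by []; rewrite /g1 /g2.
apply/funext => h /=; congr (_ *: (f _ - _)).
by rewrite [h *: 1]mulr1 scalerDl addrCA.
Qed.

Lemma derive_line f z v (t : R) :
  'D_v f (z + t *: v) = 'D_1 (fun s : R => f (z + s *: v)) t.
Proof.
rewrite /derive; apply: (congr1 (fun F => lim (F @ 0^'))).
apply/funext => h /=; congr (_ *: (f _ - _)).
by rewrite [h *: 1]mulr1 scalerDl addrCA.
Qed.

End Differentiability.

(** The increment [d] may have either sign or vanish, and the intermediate point is given by a ratio
    [s] in [0, 1], so that uses of the lemma need no case distinction. *)
Lemma MVT_line (R : realType) (V : normedModType R) (g : V -> R) z v (d : R) :
  (forall s, 0 <= s <= 1 -> derivable g (z + (s * d) *: v) v) ->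
  exists2 s, 0 <= s <= 1 & g (z + d *: v) - g z = d * 'D_v g (z + (s * d) *: v).
Proof.
move=> dg; pose p s := g (z + s *: v).
have [->|d0] := eqVneq d 0.
  by exists 0; rewrite ?lexx ?ler01// scale0r addr0 subrr mul0r.
pose I t := exists2 s, 0 <= s <= 1 & t = s * d.
have dp t : I t -> derivable p t 1 by move=> [s /dg ? ->]; exact/derivable_line.
have ip t : I t -> is_derive t 1 p ('D_v g (z + t *: v)).
  by move=> td; rewrite derive_line; exact/derivableP/dp.
have cp (i : interval R) : (forall t, t \in i -> I t) ->
    {within [set` i], continuous p}.
  by move=> h; apply: derivable_within_continuous => t /h; exact: dp.
have p0 : p 0 = g z by rewrite /p scale0r addr0.
have [dgt0|dle0] := ltP 0 d.
  have sub t : t \in `[0, d] -> I t.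
    rewrite in_itv /= => /andP[t0 td]; exists (t / d); rewrite ?divfK//.
    by rewrite divr_ge0 ?(ltW dgt0)//= ler_pdivrMr// mul1r.
  have [||c /sub[s s01 ->] cI] := @MVT_segment R p (fun t => 'D_v g (z + t *: v)) 0 d (ltW dgt0).
  - by move=> t td; apply/ip/sub/subset_itv_oo_cc.
  - exact: cp.
  by exists s => //; rewrite -p0 -/(p d) cI subr0 mulrC.
have dlt0 : d < 0 by rewrite lt_neqAle d0.
have sub t : t \in `[d, 0] -> I t.
  rewrite in_itv /= => /andP[td t0]; exists (t / d); rewrite ?divfK//.
  by rewrite ler_ndivrMr// ler_ndivlMr// mul0r mul1r t0.
have [||c /sub[s s01 ->] cI] := @MVT_segment R p (fun t => 'D_v g (z + t *: v)) d 0 dle0.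
- by move=> t td; apply/ip/sub/subset_itv_oo_cc.
- exact: cp.
by exists s => //; rewrite -p0 -/(p d) -opprB cI sub0r mulrN opprK mulrC.
Qed.

(** * Strict differentiability of C^1 maps between spaces of row vectors *)

Section RowVectors.
Variables (R : realType).

Lemma coord_le_norm n (x : 'rV[R]_n) i : `|x 0 i| <= `|x|.
Proof.
rewrite [leRHS]/Num.Def.normr /= mx_normrE.
exact: (le_bigmax _ (fun ij : 'I_1 * 'I_n => `|x ij.1 ij.2|) (0, i)).
Qed.

Lemma rV_norm_le n (x : 'rV[R]_n) (e : R) : 0 <= e ->
  (forall i, `|x 0 i| <= e) -> `|x| <= e.
Proof.
move=> e0 xe; rewrite [leLHS]/Num.Def.normr /= mx_normrE.
by apply: bigmax_le => // -[i j] _ /=; rewrite (ord1 i).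
Qed.

(** The coordinates are changed one at a time, which stays in the sup-norm ball. *)
Lemma partial_lipschitz n (g : 'rV[R]_n -> R) (x0 : 'rV[R]_n) (r e : R) : 0 <= e ->
  (forall z, `|z - x0| <= r -> forall i,
     derivable g z (delta_mx 0 i) /\ `|'D_(delta_mx 0 i) g z| <= e) ->
  forall x y, `|x - x0| <= r -> `|y - x0| <= r ->
    `|g x - g y| <= n%:R * e * `|x - y|.
Proof.
move=> e0 dg x y xr yr.
pose z k : 'rV[R]_n := \row_j (if (j < k)%N then x 0 j else y 0 j).
have r0 : 0 <= r := le_trans (normr_ge0 _) xr.
have z0 : z 0%N = y by apply/rowP => j; rewrite mxE.
have zn : z n = x by apply/rowP => j; rewrite mxE ltn_ord.
have zS (k : 'I_n) : z k.+1 = z k + (x 0 k - y 0 k) *: delta_mx 0 k.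
  apply/rowP => j; rewrite !mxE eqxx /= ltnS leq_eqVlt.
  have [->|jk] := eqVneq j k; first by rewrite eqxx /= ltnn mulr1 subrKC.
  have -> : (j == k :> nat) = false by exact: negbTE.
  by rewrite /= mulr0 addr0.
have step (k : 'I_n) : `|g (z k.+1) - g (z k)| <= e * `|x - y|.
  have I s : 0 <= s <= 1 ->
    `|z k + (s * (x 0 k - y 0 k)) *: delta_mx 0 k - x0| <= r.
    move=> /andP[s0 s1]; apply: rV_norm_le => // j; rewrite !mxE eqxx /=.
    have := le_trans (coord_le_norm _ j) xr; have := le_trans (coord_le_norm _ j) yr.
    rewrite !mxE; have [->|jk] := eqVneq j k; last first.
      by rewrite mulr0 addr0; case: ifP.
    (* In coordinate [k] the point is a convex combination of those of [x] and [y]. *)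
    rewrite ltnn mulr1 !ler_norml => /andP[h1 h2] /andP[h3 h4].
    by apply/andP; split; nra.
  have [s s01|s s01] := @MVT_line _ _ g (z k) (delta_mx 0 k) (x 0 k - y 0 k).
    by have [] := dg _ (I s s01) k.
  rewrite -zS => ->; rewrite normrM mulrC ler_pM//.
    by have [] := dg _ (I s s01) k.
  by have := coord_le_norm (x - y) k; rewrite !mxE.
have -> : g x - g y = \sum_(k < n) (g (z k.+1) - g (z k)).
  rewrite -(big_mkord xpredT (fun k => g (z k.+1) - g (z k))).
  by rewrite (telescope_sumr (fun k => g (z k)))// zn z0.
apply: le_trans (ler_norm_sum _ _ _) _.
apply: le_trans (ler_sum _ (fun k _ => step k)) _.
by rewrite sumr_const card_ord -[_ *+ n]mulr_natl mulrA.
Qed.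

Lemma rV_linear_continuous n (W : normedModType R) (l : {linear 'rV[R]_n -> W}) :
  continuous l.
Proof.
move=> x.
have -> : (l : _ -> _) = fun z : 'rV[R]_n => \sum_i z 0 i *: l 'e_i.
  apply/funext => z; rewrite {1}(row_sum_delta z) linear_sum.
  by apply: eq_bigr => i _; rewrite linearZ.
have h i : (fun z : 'rV[R]_n => z 0 i *: l 'e_i) @ x --> x 0 i *: l 'e_i.
  exact: (cvgZr_tmp (@coord_continuous R 1 n 0 i x)).
rewrite /continuous_at; apply: (@cvg_big _ _ _ _ xpredT _ _ (nbhs x)) => //.
exact: add_continuous.
Qed.

Lemma derive_linear n (W : normedModType R) (l : {linear 'rV[R]_n -> W}) x v :
  derivable l x v /\ 'D_v l x = l v.
Proof.
have dl : differentiable l x.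
  by apply: linear_differentiable; exact: rV_linear_continuous.
split; first exact: diff_derivable.
by rewrite deriveE// diff_lin//; exact: rV_linear_continuous.
Qed.

Lemma derive_row_coord (V : normedModType R) m (f : V -> 'rV[R]_m) x v j :
  derivable f x v -> 'D_v (fun z => f z 0 j) x = ('D_v f x) 0 j.
Proof. by move=> df; rewrite (derive_mx df) mxE. Qed.

(** Subtracting the linear map [l] built from the partial derivatives at [x0] leaves a function
    whose partial derivatives are small near [x0], hence one with a small Lipschitz constant there.
    Two points vary in the estimate because a contraction argument compares values at two arbitrary
    points. *)
Lemma C1_strict n m (f : 'rV[R]_n -> 'rV[R]_m) x0 :
  (\forall z \near x0, forall v, derivable f z v) ->
  (forall v, {for x0, continuous ('D_v f)}) ->
  differentiable f x0 /\
  forall e : R, 0 < e -> exists2 r : R, 0 < r &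
    forall x y, `|x - x0| <= r -> `|y - x0| <= r ->
      `|f x - f y - 'd f x0 (x - y)| <= e * `|x - y|.
Proof.
move=> df cf.
pose A := \matrix_(i < n, j < m) ('D_('e_i) f x0) 0 j.
pose l : {linear 'rV[R]_n -> 'rV[R]_m} := mulmxr A.
have le i j : (l 'e_i) 0 j = ('D_('e_i) f x0) 0 j.
  by rewrite /l /= -rowE !mxE.
have strict (e : R) : 0 < e -> exists2 r : R, 0 < r &
    forall x y, `|x - x0| <= r -> `|y - x0| <= r ->
      `|f x - f y - l (x - y)| <= e * `|x - y|.
  move=> e0.
  (* [partial_lipschitz] loses a factor [n]; the added 1 covers [n = 0]. *)
  pose d := e / (n%:R + 1).
  have d0 : 0 < d by rewrite divr_gt0 // ltr_wpDl.
  have : \forall z \near x0, (forall v, derivable f z v) /\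
     forall i : 'I_n, `|'D_('e_i) f x0 - 'D_('e_i) f z| <= d.
    near=> z; split; first by near: z.
    near: z; apply: filter_forall => i.
    by have /cvgrPdist_le := cf 'e_i; apply.
  move=> /nbhs_ballP[r /= r0 rP]; exists (r / 2); first by rewrite divr_gt0.
  move=> x y xr yr; apply: rV_norm_le => [|j].
    by rewrite mulr_ge0// ltW.
  pose g z := f z 0 j - l z 0 j.
  have {}rP z : `|z - x0| <= r / 2 -> (forall v, derivable f z v) /\
     forall i : 'I_n, `|'D_('e_i) f x0 - 'D_('e_i) f z| <= d.
    move=> zr; apply: rP; rewrite -ball_normE /= distrC (le_lt_trans zr)//.
    by rewrite gtr_pMr// invf_lt1// ltr1n.
  have -> : (f x - f y - l (x - y)) 0 j = g x - g y.
    by rewrite linearB /g !mxE; ring.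
  apply: le_trans (@partial_lipschitz n g x0 (r / 2) d (ltW d0) _ x y xr yr) _.
    move=> z /rP[dfz cfz] i.
    have dfij : derivable (fun z => f z 0 j) z 'e_i.
      exact: ((derivable_mxP _ _ _).1 (dfz 'e_i) 0 j).
    have [dl lE] := derive_linear l z 'e_i.
    have dlij : derivable (fun z => l z 0 j) z 'e_i.
      exact: ((derivable_mxP _ _ _).1 dl 0 j).
    split; first exact: derivableB.
    rewrite deriveB//.
    rewrite (derive_row_coord j (dfz 'e_i)) (derive_row_coord j dl) lE.
    rewrite le distrC; have := coord_le_norm ('D_('e_i) f x0 - 'D_('e_i) f z) j.
    by rewrite !mxE => /le_trans; apply.
  have n1 : 0 < n%:R + 1 :> R by rewrite ltr_wpDl.
  by rewrite ler_wpM2r// /d mulrCA ger_pMr// ler_pdivrMr// mul1r lerDl.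
have [dfx dfl] : differentiable f x0 /\ 'd f x0 = l :> (_ -> _).
  apply: approx_diff; first exact: rV_linear_continuous.
  move=> e /strict[r r0 rP]; apply/nbhs_ballP; exists r => //= y.
  rewrite -ball_normE /= distrC => /ltW yr; apply: rP => //.
  by rewrite subrr normr0 ltW.
by split=> // e /strict[r r0 rP]; exists r => // x y xr yr; rewrite dfl; exact: rP.
Unshelve. all: by end_near. Qed.

Lemma Ck1_strict n m (U : set 'rV[R]_n) (f : 'rV[R]_n -> 'rV[R]_m) x0 :
  open U -> U x0 -> Ck 1 U f ->
  differentiable f x0 /\
  forall e : R, 0 < e -> exists2 r : R, 0 < r &
    forall x y, `|x - x0| <= r -> `|y - x0| <= r ->
      `|f x - f y - 'd f x0 (x - y)| <= e * `|x - y|.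
Proof.
move=> oU Ux0 [cf df]; apply: C1_strict => [|v].
  apply: filterS (open_nbhs_nbhs (conj oU Ux0)) => z Uz v.
  by have [+ _] := df v; exact.
by have [_ [+ _]] := df v; exact.
Qed.

Lemma Ck1_differentiable n m (U : set 'rV[R]_n) (f : 'rV[R]_n -> 'rV[R]_m) x0 :
  open U -> U x0 -> Ck 1 U f -> differentiable f x0.
Proof. by move=> oU Ux0 /(Ck1_strict oU Ux0)[]. Qed.

(** The scalar function is viewed as the row [g] with a single entry, to which [C1_strict]
    applies. *)
Lemma Ck1_differentiable_scalar n (U : set 'rV[R]_n) (f : 'rV[R]_n -> R^o) x0 :
  open U -> U x0 -> Ck 1 U f -> differentiable (f : _ -> R) x0.
Proof.
move=> oU Ux0 [cf df].
pose g z : 'rV[R]_1 := \row_j f z.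
have gE : f = (fun M : 'rV[R]_1 => M 0 0) \o g.
  by apply/funext => z; rewrite /= mxE.
have dg z v : U z -> derivable g z v.
  move=> Uz; apply/derivable_mxP => i j.
  rewrite (_ : (fun _ => _) = f); last by apply/funext => ?; rewrite mxE.
  by have [+ _] := df v; exact.
have nU := open_nbhs_nbhs (conj oU Ux0).
have [|v|dg0 _] := @C1_strict n 1 g x0.
- by apply: filterS nU => z Uz v; exact: dg.
- have [_ [cDf _]] := df v.
  have E : \forall z \near x0, (\row__ 'D_v f z : 'rV[R]_1) = 'D_v g z.
    apply: filterS nU => z Uz; rewrite derive_mx; last exact: dg.
    apply/rowP => j; rewrite !mxE; congr ('D_v _ z).
    by apply/funext => ?; rewrite mxE.
  rewrite /prop_for /continuous_at -(nbhs_singleton E).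
  apply: cvg_trans; first exact: (near_eq_cvg E).
  apply/cvgrPdist_le => e e0; have /cvgrPdist_le/(_ e e0) := cDf _ Ux0.
  apply: filterS => z h; apply: rV_norm_le => [|i]; first exact: ltW.
  by rewrite !mxE.
rewrite gE; apply: differentiable_comp => //; exact: differentiable_coord.
Qed.
End RowVectors.

(** Completeness of row vectors is what [banach_fixed_point] requires in [local_surjection]. *)
HB.instance Definition _ (R : realType) (m n : nat) :=
  Uniform_isComplete.Build 'M[R]_(m, n) cauchy_cvg.

(** * Factoring differentiable maps through submersions and immersions *)

Section Factorization.
Variable R : realType.

Lemma surjective_linear_section n m (l : {linear 'rV[R]_n -> 'rV[R]_m}) :
  (forall w, exists v, l v = w) ->
  exists s : {linear 'rV[R]_m -> 'rV[R]_n}, forall w, l (s w) = w.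
Proof.
move=> /choice[u lu].
pose s : {linear 'rV[R]_m -> 'rV[R]_n} := mulmxr (\matrix_i u ('e_i)).
exists s => w; rewrite [in RHS](row_sum_delta w) /s /= mulmx_sum_row linear_sum.
by apply: eq_bigr => i _; rewrite linearZ rowK lu.
Qed.

Lemma injective_linear_retraction n m (l : {linear 'rV[R]_n -> 'rV[R]_m}) :
  injective l ->
  exists b : {linear 'rV[R]_m -> 'rV[R]_n}, forall v, b (l v) = v.
Proof.
move=> il; pose A := lin1_mx l.
have fA : row_free A.
  rewrite -kermx_eq0; apply/eqP/row_matrixP => i; rewrite row0.
  by apply: il; rewrite linear0 -(mul_rV_lin1 l) -row_mul mulmx_ker row0.
exists (mulmxr (pinvmx A)) => v /=.
by rewrite -(mul_rV_lin1 l) -mulmxA mulmxVp// mulmx1.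
Qed.

Lemma linear_bounded n (W : normedModType R) (l : {linear 'rV[R]_n -> W}) :
  exists2 B : R, 0 < B & forall x, `|l x| <= B * `|x|.
Proof. exact/linear_lipschitz/rV_linear_continuous. Qed.

(** Fixed point of the contraction [w |-> w - (f (x0 + s w) - q)]. *)
Lemma local_surjection n m (f : 'rV[R]_n -> 'rV[R]_m) x0
    (s : {linear 'rV[R]_m -> 'rV[R]_n}) :
  (forall w, 'd f x0 (s w) = w) ->
  (forall e : R, 0 < e -> exists2 r : R, 0 < r &
    forall x y, `|x - x0| <= r -> `|y - x0| <= r ->
      `|f x - f y - 'd f x0 (x - y)| <= e * `|x - y|) ->
  exists2 d : R, 0 < d & forall q, `|q - f x0| <= d ->
    exists2 w, `|w| <= 2 * `|q - f x0| & f (x0 + s w) = q.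
Proof.
move=> fs strict; have [B B0 sB] := linear_bounded s.
(* As [s] has norm at most [B], this error makes the map [h] below a contraction of ratio 1/2. *)
have [|r r0 fr] := strict (2 * B)^-1; first by rewrite invr_gt0 mulr_gt0.
pose rho := r / B; have rho0 : 0 < rho by rewrite divr_gt0.
(* With this radius [h] maps the ball of radius [rho] to itself, since [h 0 = q - f x0] and the
   contraction contributes at most [rho / 2]. *)
exists (rho / 2) => [|q qd]; first by rewrite divr_gt0.
pose U : set 'rV[R]_m := [set w | `|w| <= rho].
pose h w := w - (f (x0 + s w) - q).
have hL w w' : U w -> U w' -> `|h w - h w'| <= 2^-1 * `|w - w'|.
  have sU z : U z -> `|x0 + s z - x0| <= r.
    move=> zU; rewrite addrC addKr; apply: le_trans (sB z) _.
    by rewrite -ler_pdivlMl// mulrC.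
  move=> wU wU'; have sD : (x0 + s w) - (x0 + s w') = s (w - w').
    by rewrite linearB /= opprD addrACA subrr add0r.
  have -> : h w - h w' =
      - (f (x0 + s w) - f (x0 + s w') - 'd f x0 ((x0 + s w) - (x0 + s w'))).
    by rewrite sD fs /h; apply/rowP => j; rewrite !mxE; ring.
  rewrite normrN; apply: le_trans (fr _ _ (sU _ wU) (sU _ wU')) _.
  rewrite sD; apply: (@le_trans _ _ ((2 * B)^-1 * (B * `|w - w'|))).
    by rewrite ler_wpM2l// invr_ge0 mulr_ge0// ltW.
  by rewrite invfM mulrA mulfVK// gt_eqF.
have h0 : h 0 = q - f x0 by rewrite /h linear0 addr0 sub0r opprB.
have U0 : U 0 by rewrite /U /= normr0 ltW.
have hle w : U w -> `|h w| <= 2^-1 * `|w| + `|q - f x0|.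
  move=> Uw; rewrite -[h w](subrK (h 0)) h0; apply: le_trans (ler_normD _ _) _.
  by rewrite lerD2r -h0; have := hL _ _ Uw U0; rewrite subr0.
have hU : set_fun U U h.
  move=> w Uw; rewrite /U /=; apply: le_trans (hle _ Uw) _.
  have : `|w| <= rho by [].
  by move: qd; lra.
have [|||w Uw hw] := @banach_fixed_point R 'rV[R]_m U (mkfun hU).
- exists (2^-1)%:nng; split; first by rewrite /= invf_lt1// ltr1n.
  by move=> [w w'] [/= Uw Uw']; exact: hL.
- rewrite (_ : U = closed_ball_ (fun x => `|x|) 0 rho).
    exact: closed_closed_ball_.
  by apply/seteqP; split=> w /=; rewrite /closed_ball_ /= sub0r normrN.
- by exists 0.
have {}hw : w = h w := hw.
(* At the fixed point [hle] reads [|w| <= |w| / 2 + |q - f x0|], which is the linear bound. *)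
exists w; first by have := hle _ Uw; rewrite -hw; lra.
move: hw; rewrite /h => /eqP; rewrite -subr_eq0 opprB addrC subrK.
by rewrite subr_eq0 => /eqP.
Qed.

(** Every [q] near [p x0] is [p (x0 + s w)] with [w] of size at most [2 * |q - p x0|], so
    [b q = g (x0 + s w)]. Expanding [g] gives ['d g x0 (s w)] up to a small error, and expanding [p]
    shows that [w] is [q - p x0] up to a small error. The linear bound on [w] turns both errors into
    multiples of [|q - p x0|]; the lift need not depend continuously on [q]. *)
Lemma differentiable_submersion_descent n m k (p : 'rV[R]_n -> 'rV[R]_m)
    (g : 'rV[R]_n -> 'rV[R]_k) (b : 'rV[R]_m -> 'rV[R]_k) x0 :
  differentiable p x0 -> (forall w, exists v, 'd p x0 v = w) ->
  (forall e : R, 0 < e -> exists2 r : R, 0 < r &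
    forall x y, `|x - x0| <= r -> `|y - x0| <= r ->
      `|p x - p y - 'd p x0 (x - y)| <= e * `|x - y|) ->
  differentiable g x0 -> (\forall x \near x0, b (p x) = g x) ->
  differentiable b (p x0).
Proof.
move=> dp /surjective_linear_section[s ps] strict dg bpg.
have [d d0 surj] := local_surjection ps strict.
have bx0 := nbhs_singleton bpg.
pose l : {linear 'rV[R]_m -> 'rV[R]_k} := 'd g x0 \o s.
have [] // := @approx_diff R _ _ b (p x0) l; first exact: rV_linear_continuous.
move=> e e0.
have [B B0 sB] := linear_bounded s; have [D D0 lD] := linear_bounded l.
(* Since [|s w| <= 2 * B * t], each of the two errors contributes [e / 2 * t]; [D] accounts for
   applying [l] to the error of [p]. *)
have e10 : 0 < e / (4 * B) by rewrite divr_gt0// mulr_gt0.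
have e20 : 0 < e / (4 * (D * B)) by rewrite divr_gt0// !mulr_gt0.
have H : \forall x \near x0, [/\ b (p x) = g x,
    `|g x - g x0 - 'd g x0 (x - x0)| <= e / (4 * B) * `|x - x0| &
    `|p x - p x0 - 'd p x0 (x - x0)| <= e / (4 * (D * B)) * `|x - x0|].
  by apply: filterS3 bpg (diff_approx dg e10) (diff_approx dp e20) => x.
have /nbhs_ballP[r /= r0 rP] := H.
near=> q.
pose t := `|q - p x0|.
have td : t <= d.
  rewrite /t distrC; near: q; apply/nbhs_ballP; exists d => //= q.
  by rewrite -ball_normE => /ltW.
have tr : t < r / (2 * B).
  rewrite /t distrC; near: q; apply/nbhs_ballP.
  by exists (r / (2 * B)) => /=; [rewrite divr_gt0// mulr_gt0|rewrite -ball_normE].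
have [w wq qE] := surj q td; rewrite -/t in wq.
have swB : `|s w| <= 2 * B * t.
  by apply: le_trans (sB w) _; rewrite -mulrA mulrCA ler_pM2l.
have [|bE gE pE] := rP (x0 + s w).
  rewrite -ball_normE /= opprD addNKr normrN (le_lt_trans swB)//.
  by rewrite -ltr_pdivlMl ?mulr_gt0// mulrC.
rewrite qE [x0 + _]addrC addrK ps in bE gE pE.
rewrite bE bx0.
have -> : g (s w + x0) - g x0 - l (q - p x0) =
  (g (s w + x0) - g x0 - 'd g x0 (s w)) - l (q - p x0 - w).
  by rewrite [l (_ - w)]linearB opprB /= subrKA.
apply: le_trans (ler_normB _ _) _; rewrite [leRHS]splitr lerD//.
  apply: le_trans gE _.
  apply: (@le_trans _ _ (e / (4 * B) * (2 * B * t))).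
    by rewrite ler_wpM2l// ltW.
  rewrite le_eqVlt; apply/orP; left; apply/eqP; rewrite -/t.
  by field; rewrite gt_eqF.
apply: le_trans (lD _) _.
apply: (@le_trans _ _ (D * (e / (4 * (D * B)) * (2 * B * t)))).
  by rewrite ler_pM2l//; apply: le_trans pE _; rewrite ler_wpM2l// ltW.
rewrite le_eqVlt; apply/orP; left; apply/eqP; rewrite -/t.
by field; rewrite !gt_eqF.
Unshelve. all: by end_near. Qed.

(** A left inverse [b] of the derivative of [i] expresses [u - l h] by the errors of [j] and of [i].
    The error of [i] is measured by the unknown increment [u] of [sg]; continuity of [sg] makes that
    error estimate available, and the term in [u] is then absorbed. *)
Lemma differentiable_immersion_lift n m k (i : 'rV[R]_m -> 'rV[R]_k)
    (j : 'rV[R]_n -> 'rV[R]_k) (sg : 'rV[R]_n -> 'rV[R]_m) x0 :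
  differentiable i (sg x0) -> injective ('d i (sg x0)) ->
  differentiable j x0 -> {for x0, continuous sg} ->
  (\forall x \near x0, i (sg x) = j x) ->
  differentiable sg x0.
Proof.
move=> di /injective_linear_retraction[b bi] dj csg ij.
have ij0 := nbhs_singleton ij.
pose l : {linear 'rV[R]_n -> 'rV[R]_m} := b \o 'd j x0.
have [] // := @approx_diff R _ _ sg x0 l; first exact: rV_linear_continuous.
move=> e e0.
have [B B0 bB] := linear_bounded b; have [D D0 lD] := linear_bounded l.
(* The first bound gives [B * d <= 1/2], which absorbs [u] and yields [|u| <= (2 * D + 1) * |h|];
   the second makes the resulting total [B * d * (2 * D + 2)] at most [e]. *)
pose d := Num.min (1 / (2 * B)) (e / (B * (2 * D + 2))).
have d0 : 0 < d.
  by rewrite lt_min !divr_gt0// mulr_gt0// addr_gt0// mulr_gt0.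
near=> x.
have ijx : i (sg x) = j x by near: x.
have dix : `|i (sg x) - i (sg x0) - 'd i (sg x0) (sg x - sg x0)|
    <= d * `|sg x - sg x0|.
  by near: x; apply: (csg _ (diff_approx di d0)).
have djx : `|j x - j x0 - 'd j x0 (x - x0)| <= d * `|x - x0|.
  by near: x; exact: (diff_approx dj d0).
set u := sg x - sg x0 in dix *; set h := x - x0 in djx *.
have uE : u - l h = b (j x - j x0 - 'd j x0 h) -
    b (i (sg x) - i (sg x0) - 'd i (sg x0) u).
  have E (z a c : 'rV[R]_k) : z - a - (z - c) = c - a.
    by apply/rowP => ?; rewrite !mxE; ring.
  by rewrite ijx ij0 -[RHS](linearB b) E [RHS]linearB bi.
have u1 : `|u - l h| <= B * (d * `|h|) + B * (d * `|u|).
  rewrite uE; apply: le_trans (ler_normB _ _) _; rewrite lerD//.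
    by apply: le_trans (bB _) _; rewrite ler_pM2l.
  by apply: le_trans (bB _) _; rewrite ler_pM2l.
have u2 : `|u| <= `|u - l h| + D * `|h|.
  rewrite -{1}[u](subrK (l h)); apply: le_trans (ler_normD _ _) _.
  by rewrite lerD2l.
have d1 : B * d <= 1 / 2.
  rewrite mulrC -ler_pdivlMr//.
  by rewrite ge_min invfM mulrA lexx.
have d2 : B * d * (2 * D + 2) <= e.
  rewrite mulrAC mulrC -ler_pdivlMr; last by rewrite mulr_gt0// addr_gt0// mulr_gt0.
  by rewrite /d ge_min lexx orbT.
have h0 : 0 <= `|h| by []. have u0 : 0 <= `|u| by [].
have u3 : `|u| <= (2 * D + 1) * `|h|.
  have : B * d * `|h| <= 1/2 * `|h| by rewrite ler_wpM2r.
  have : B * d * `|u| <= 1/2 * `|u| by rewrite ler_wpM2r.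
  by move: u1 u2; rewrite !mulrA; nra.
apply: le_trans u1 _.
apply: le_trans (_ : B * d * (2 * D + 2) * `|h| <= _); last by rewrite ler_wpM2r.
have : B * d * `|u| <= B * d * ((2 * D + 1) * `|h|).
  by rewrite ler_wpM2l// mulr_ge0// ltW.
by rewrite !mulrA; nra.
Unshelve. all: by end_near. Qed.

End Factorization.

(** * Symmetry of second derivatives *)

Section SecondOrder.
Variable R : realType.

(** Weaker than C^2, but stable under composition and sufficient for the symmetry of
    second derivatives. *)
Definition diff2 (V W : normedModType R) (f : V -> W) (x : V) : Prop :=
  (\forall z \near x, differentiable f z) /\
  forall v, differentiable ('D_v f) x.

Lemma near_eq_diff2 (V W : normedModType R) (f g : V -> W) x :
  (\forall z \near x, f z = g z) -> diff2 f x -> diff2 g x.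
Proof.
move=> /near_join fg [df ddf]; split=> [|v].
  by apply: filterS2 fg df => z; exact: near_eq_differentiable.
apply: near_eq_differentiable (ddf v).
by apply: filterS fg => z; exact: near_eq_derive.
Qed.

Lemma derivable_translate (V W : normedModType R) (f : V -> W) (a z v : V) :
  derivable f (z + a) v -> derivable (fun y => f (y + a)) z v /\
  'D_v (fun y => f (y + a)) z = 'D_v f (z + a).
Proof.
rewrite /derive /derivable; set g1 := fun h => _; set g2 := fun h => _.
suff -> : g2 = g1 by [].
by apply/funext => h; rewrite /g1 /g2 /= addrA.
Qed.

(** The mean value theorem along [v] for [g z = f (z + t *: w) - f z] turns the second difference
    into [t] times a difference of two values of ['D_v f]; both are then expanded at [x], and the
    parts along [v] cancel. *)
Lemma second_difference (V : normedModType R) (f : V -> R) x v w :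
  (\forall z \near x, differentiable f z) -> differentiable ('D_v f) x ->
  forall e : R, 0 < e -> \forall t \near (0 : R),
    `|f (x + t *: v + t *: w) - f (x + t *: v) - (f (x + t *: w) - f x)
      - t * (t * 'D_w ('D_v f) x)| <= e * `|t| * `|t|.
Proof.
move=> df ddf e e0.
(* The two points at which ['D_v f] is expanded lie within [|t| * (|v| + |w|)] and [|t| * |v|] of
   [x]; the 1 keeps [c] positive. *)
pose c := `|v| + `|v| + `|w| + 1.
have c0 : 0 < c by rewrite ltr_wpDl// !addr_ge0.
have ec0 : 0 < e / c by rewrite divr_gt0.
have H : \forall z \near x, differentiable f z /\
    `|'D_v f z - 'D_v f x - 'd ('D_v f) x (z - x)| <= e / c * `|z - x|.
  exact: filterI df (diff_approx ddf ec0).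
have /nbhs_ballP[r /= r0 rP] := H.
have rc0 : 0 < r / c by rewrite divr_gt0.
apply/nbhs_ballP; exists (r / c) => //= t.
rewrite -ball_normE /= sub0r normrN ltr_pdivlMr// => tr.
have I (a b : R) : 0 <= a <= 1 -> 0 <= b <= 1 ->
    `|(a * t) *: v + (b * t) *: w| <= `|t| * (`|v| + `|w|).
  move=> /andP[a0 a1] /andP[b0 b1].
  rewrite (le_trans (ler_normD _ _))// mulrDr lerD// normrZ ler_wpM2r//.
    by rewrite normrM ger0_norm// ler_piMl.
  by rewrite normrM ger0_norm// ler_piMl.
have Ball (a b : R) : 0 <= a <= 1 -> 0 <= b <= 1 ->
    ball x r (x + ((a * t) *: v + (b * t) *: w)).
  move=> a01 b01; rewrite -ball_normE /= opprD addNKr normrN.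
  apply: le_lt_trans (I _ _ a01 b01) _; apply: le_lt_trans tr.
  by rewrite ler_wpM2l// /c; have := normr_ge0 v; lra.
have i0 : 0 <= (0 : R) <= 1 by rewrite lexx ler01.
have i1 : 0 <= (1 : R) <= 1 by rewrite lexx ler01.
pose g z := f (z + t *: w) - f z.
have dg s : 0 <= s <= 1 -> derivable g (x + (s * t) *: v) v /\
    'D_v g (x + (s * t) *: v) =
      'D_v f (x + (s * t) *: v + t *: w) - 'D_v f (x + (s * t) *: v).
  move=> s01.
  have [d1 _] := rP _ (Ball s 1 s01 i1); have [d2 _] := rP _ (Ball s 0 s01 i0).
  rewrite mul1r addrA in d1; rewrite mul0r scale0r addr0 in d2.
  have [d3 E3] := derivable_translate (@diff_derivable _ _ _ _ _ v d1).
  have d4 := @diff_derivable _ _ _ _ _ v d2.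
  split; first exact: (derivableB d3 d4).
  by rewrite (deriveB d3 d4) E3.
have [s /dg[]//|s s01] := @MVT_line R V g x v t.
rewrite /g (dg s s01).2 => ->.
have [_ h1] := rP _ (Ball s 1 s01 i1); have [_ h2] := rP _ (Ball s 0 s01 i0).
move: h1 h2; rewrite mul1r mul0r scale0r addr0 addrA.
set A := 'D_v f (x + _ + _); set B := 'D_v f (x + _); set C := 'D_v f x.
have -> : x + (s * t) *: v + t *: w - x = (s * t) *: v + t *: w.
  by rewrite addrAC [x + _]addrC addrK.
have -> : x + (s * t) *: v - x = (s * t) *: v by rewrite addrC addKr.
set E := 'D_w _ x; set D := 'd ('D_v f) x ((s * t) *: v).
have -> : 'd ('D_v f) x ((s * t) *: v + t *: w) = D + t * E.
  by rewrite linearD [X in _ + X]linearZ /E deriveE.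
move=> h1 h2.
have {}h1 : `|A - C - (D + t * E)| <= e / c * (`|t| * (`|v| + `|w|)).
  apply: le_trans h1 _; rewrite ler_wpM2l ?(ltW ec0)//.
  by have := I s 1 s01 i1; rewrite mul1r.
have {}h2 : `|B - C - D| <= e / c * (`|t| * `|v|).
  apply: le_trans h2 _; rewrite ler_wpM2l ?(ltW ec0)// normrZ ler_wpM2r//.
  by case/andP: s01 => ? ?; rewrite normrM ger0_norm// ler_piMl.
rewrite -mulrBr normrM mulrC ler_wpM2r//.
have -> : A - B - t * E = (A - C - (D + t * E)) - (B - C - D) by ring.
apply: le_trans (ler_normB _ _) _; apply: le_trans (lerD h1 h2) _.
rewrite -!mulrDr (_ : e * `|t| = e / c * (`|t| * c)); last first.
  by field; rewrite gt_eqF.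
by rewrite ler_wpM2l ?(ltW ec0)// ler_wpM2l// /c; lra.
Qed.

Lemma second_difference_le (t e p q r s a b : R) : 0 < t ->
  `|p - q - (r - s) - t * (t * a)| <= e / 2 * t * t ->
  `|p - r - (q - s) - t * (t * b)| <= e / 2 * t * t -> `|a - b| <= e.
Proof.
move=> t0 h1 h2; rewrite -(ler_pM2l (mulr_gt0 t0 t0)).
rewrite -{1}(gtr0_norm (mulr_gt0 t0 t0)) -normrM.
have -> : t * t * (a - b) = (p - r - (q - s) - t * (t * b)) -
    (p - q - (r - s) - t * (t * a)) by ring.
apply: le_trans (ler_normB _ _) _; apply: le_trans (lerD h2 h1) _.
by rewrite le_eqVlt; apply/orP; left; apply/eqP; field.
Qed.

(** The second difference is symmetric in [v] and [w] and approximates [t * t] times either mixed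
    derivative. *)
Lemma diff2_sym_scalar (V : normedModType R) (f : V -> R) x v w :
  diff2 f x -> 'D_w ('D_v f) x = 'D_v ('D_w f) x.
Proof.
move=> [df ddf]; apply/eqP; rewrite -subr_eq0 -normr_eq0 eq_le normr_ge0 andbT.
apply/ler_addgt0Pr => e e0; rewrite add0r.
have e20 : 0 < e / 2 by rewrite divr_gt0.
have H1 := @second_difference V f x v w df (ddf v) _ e20.
have H2 := @second_difference V f x w v df (ddf w) _ e20.
have /nbhs_ballP[r1 /= r10 P1] := H1; have /nbhs_ballP[r2 /= r20 P2] := H2.
pose t := Num.min r1 r2 / 2.
have r120 : 0 < Num.min r1 r2 by rewrite lt_min r10.
have t0 : 0 < t by rewrite divr_gt0.
have tr : t < Num.min r1 r2 by rewrite gtr_pMr// invf_lt1// ltr1n.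
have [tr1 tr2] : ball 0 r1 t /\ ball 0 r2 t.
  by rewrite -!ball_normE /= sub0r normrN (gtr0_norm t0); apply/andP; rewrite -lt_min.
have {P1 P2} := conj (P1 t tr1) (P2 t tr2).
rewrite /= (gtr0_norm t0) [x + t *: w + _]addrAC.
move=> [h1 h2]; exact: second_difference_le t0 h1 h2.
Qed.

Lemma differentiable_rowP (V : normedModType R) m (f : V -> 'rV[R]_m) x :
  differentiable f x <-> forall j, differentiable (fun z => f z 0 j) x.
Proof.
split=> [df j|df].
  apply: (@differentiable_comp _ _ _ _ f (fun M : 'rV[R]_m => M 0 j)) => //.
  exact: differentiable_coord.
have -> : f = \sum_j (fun z => f z 0 j *: 'e_j).
  apply/funext => z; rewrite fct_sumE; exact: row_sum_delta.
by apply: differentiable_sum => j; exact: differentiableZl.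
Qed.

Lemma diff2_coord (V : normedModType R) m (f : V -> 'rV[R]_m) x j :
  diff2 f x -> diff2 (fun z => f z 0 j) x.
Proof.
move=> [df ddf]; split=> [|v].
  by apply: filterS df => z /differentiable_rowP/(_ j).
have /differentiable_rowP/(_ j) := ddf v; apply: near_eq_differentiable.
apply: filterS df => z dz; rewrite derive_row_coord//; exact: diff_derivable.
Qed.

Lemma diff2_sym (V : normedModType R) m (f : V -> 'rV[R]_m) x v w :
  diff2 f x -> 'D_w ('D_v f) x = 'D_v ('D_w f) x.
Proof.
move=> d2f; have [df ddf] := d2f; apply/rowP => j.
have E a b : ('D_a ('D_b f) x) 0 j = 'D_a ('D_b (fun z => f z 0 j)) x.
  rewrite -derive_row_coord; last exact: diff_derivable.
  apply: near_eq_derive; apply: filterS df => z dz.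
  by rewrite derive_row_coord//; exact: diff_derivable.
apply: (etrans (E w v)); apply: (etrans _ (esym (E v w))).
exact: (diff2_sym_scalar v w (diff2_coord j d2f)).
Qed.

Lemma derive_comp (U V W : normedModType R) (f : U -> V) (g : V -> W) x v :
  differentiable f x -> differentiable g (f x) ->
  'D_v (g \o f) x = 'D_('D_v f x) g (f x).
Proof.
move=> df dg; rewrite !deriveE//; last exact: differentiable_comp.
by rewrite diff_comp.
Qed.

Lemma derive_row_sum n (W : normedModType R) (f : 'rV[R]_n -> W) x v :
  differentiable f x -> 'D_v f x = \sum_i v 0 i *: 'D_('e_i) f x.
Proof.
move=> df; rewrite deriveE// {1}(row_sum_delta v) linear_sum.
by apply: eq_bigr => i _; rewrite linearZ deriveE.
Qed.

(** The direction ['D_v f z] in the chain rule moves with [z]. Expanding it in the standard basis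
    writes ['D_v (g \o f)] as a sum of products of differentiable functions. *)
Lemma diff2_comp (V : normedModType R) m k (f : V -> 'rV[R]_m)
    (g : 'rV[R]_m -> 'rV[R]_k) x :
  diff2 f x -> diff2 g (f x) -> diff2 (g \o f) x.
Proof.
move=> [df ddf] [dg ddg].
have dfx := nbhs_singleton df.
have cf : {for x, continuous f} by exact: differentiable_continuous.
have dgf : \forall z \near x, differentiable g (f z) by exact: (cf _ dg).
split=> [|v].
  by apply: filterS2 df dgf => z; exact: differentiable_comp.
apply/differentiable_rowP => j.
pose h z := \sum_i (fun z => ('D_v f z) 0 i * ('D_('e_i) g (f z)) 0 j) z.
apply: (@near_eq_differentiable _ _ _ h).
  apply: filterS2 df dgf => z dz dgz.
  rewrite derive_comp// derive_row_sum// summxE.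
  by apply: eq_bigr => i _; rewrite mxE.
rewrite (_ : h = \sum_i (fun z => ('D_v f z) 0 i * ('D_('e_i) g (f z)) 0 j)).
  apply: differentiable_sum => i; apply: differentiableM.
    by move/differentiable_rowP: (ddf v); exact.
  apply: (@differentiable_comp _ _ _ _ f (fun y => ('D_('e_i) g y) 0 j)) => //.
  by move/differentiable_rowP: (ddg 'e_i); exact.
by apply/funext => z; rewrite fct_sumE.
Qed.

Lemma Ck2_diff2 n m (U : set 'rV[R]_n) (f : 'rV[R]_n -> 'rV[R]_m) x :
  open U -> U x -> Ck 2 U f -> diff2 f x.
Proof.
move=> oU Ux [cf df]; split=> [|v].
  apply: filterS (open_nbhs_nbhs (conj oU Ux)) => z Uz.
  apply: (Ck1_differentiable oU Uz); split=> // v.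
  have [dfv [cDf _]] := df v; split=> //.
by have [_ /(Ck1_differentiable oU Ux)] := df v.
Qed.

End SecondOrder.

(** * Alternating multilinear functions on lists *)

Section Deletion.
Variable T : Type.
Implicit Types s : seq T.

(** The arguments left in the term of index [i] of [extd]. *)
Definition del (i : nat) s := take i s ++ drop i.+1 s.

Lemma del_del i l s : (i <= l)%N -> del l (del i s) = del i (del l.+1 s).
Proof.
elim: s i l => [|x s ih] [|i] [|l] // il.
- by rewrite /del /= !drop0.
- by rewrite /del /= !drop0.
- by rewrite /del /=; congr cons; apply: ih.
Qed.

Lemma nth_del_ge x0 i l s : (i <= l)%N -> nth x0 (del i s) l = nth x0 s l.+1.
Proof.
elim: s i l => [|x s ih] [|i] [|l] // il; rewrite /del /= ?drop0 ?nth_nil//.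
exact: ih.
Qed.

Lemma nth_del_lt x0 i l s : (i < l)%N -> nth x0 (del l s) i = nth x0 s i.
Proof.
elim: s i l => [|x s ih] [|i] [|l] // il; rewrite /del /= ?nth_nil//.
exact: ih.
Qed.

Lemma size_del i s : (i < size s)%N -> size (del i s) = (size s).-1.
Proof.
move=> is_; rewrite size_cat size_takel ?(ltnW is_)// size_drop.
by rewrite -(ltn_predK is_) subSS subnKC// -ltnS (ltn_predK is_).
Qed.

End Deletion.

Lemma map_del (T T' : Type) (f : T -> T') i s : map f (del i s) = del i (map f s).
Proof. by rewrite /del map_cat map_take map_drop. Qed.

Section Multilinear.
Variables (R : realType) (V : lmodType R).
Implicit Types (a : seq V -> R) (s : seq V).

Definition multilinear_seq a := forall s1 s2 (c : R) (u v : V),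
  a (s1 ++ (c *: u + v) :: s2) = c * a (s1 ++ u :: s2) + a (s1 ++ v :: s2).

Definition alternating_seq a := forall s1 s2 s3 (u : V),
  a (s1 ++ u :: s2 ++ u :: s3) = 0.

Lemma multilinear_seq_sum a s1 s2 (I : Type) (r : seq I) (c : I -> R) (u : I -> V) :
  multilinear_seq a ->
  a (s1 ++ (\sum_(i <- r) c i *: u i) :: s2) =
  \sum_(i <- r) c i * a (s1 ++ u i :: s2).
Proof.
move=> ma; elim: r => [|i r ih]; last by rewrite !big_cons ma ih.
rewrite !big_nil; have := ma s1 s2 1 0 0.
by rewrite scaler0 addr0 mul1r => /esym/eqP; rewrite -subr_eq0 addrK => /eqP.
Qed.

Lemma alternating_seq_swap a s1 s2 u v : multilinear_seq a -> alternating_seq a ->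
  a (s1 ++ u :: v :: s2) = - a (s1 ++ v :: u :: s2).
Proof.
move=> ma aa; apply/eqP; rewrite -addr_eq0; apply/eqP.
have D (t1 t2 : seq V) x y : a (t1 ++ (x + y) :: t2) = a (t1 ++ x :: t2) + a (t1 ++ y :: t2).
  by rewrite -[x in x + y]scale1r ma mul1r.
have := aa s1 [::] s2 (u + v); rewrite /= D.
have D2 x : a (s1 ++ [:: x, u + v & s2]) =
    a (s1 ++ [:: x, u & s2]) + a (s1 ++ [:: x, v & s2]).
  by have := D (rcons s1 x) s2 u v; rewrite !cat_rcons.
have A0 x : a (s1 ++ [:: x, x & s2]) = 0 := aa s1 [::] s2 x.
by rewrite !D2 !A0 addr0 add0r.
Qed.

Lemma alternating_seq_front a s1 s2 u : multilinear_seq a -> alternating_seq a ->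
  a (s1 ++ u :: s2) = (-1) ^+ size s1 * a (u :: s1 ++ s2).
Proof.
move=> ma aa; elim/last_ind: s1 s2 => [|s1 x ih] s2; first by rewrite mul1r.
rewrite cat_rcons alternating_seq_swap// ih -cat_rcons size_rcons exprS mulN1r.
by rewrite mulNr.
Qed.

(** The terms [(i, l)] and [(l + 1, i)], for [i <= l], cancel. *)
Lemma alternating_second_order (U : Type) (u0 : U) a (B : U -> U -> V) (D : U -> V)
    (s : seq U) :
  multilinear_seq a -> alternating_seq a -> (forall u w, B u w = B w u) ->
  \sum_(i < size s) (-1) ^+ i * \sum_(l < size (del i s))
    a (take l (map D (del i s)) ++ B (nth u0 s i) (nth u0 (del i s) l) ::
       drop l.+1 (map D (del i s))) = 0 :> R.
Proof.
move=> ma aa Bsym.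
case sz : (size s) => [|N]; first by rewrite big_ord0.
pose t (i l : nat) : R := (-1) ^+ (i + l) *
  a (B (nth u0 s i) (nth u0 (del i s) l) :: map D (del l (del i s))).
transitivity (\sum_(i < N.+1) \sum_(l < N) t i l).
  apply: eq_bigr => i _.
  have szi : size (del i s) = N by rewrite size_del sz.
  rewrite szi mulr_sumr; apply: eq_bigr => l _.
  rewrite alternating_seq_front// size_takel; last first.
    by rewrite size_map szi ltnW.
  by rewrite mulrA -exprD /t (map_del D l).
transitivity (\sum_(i < N.+1) \sum_(l < N | (i <= l)%N) t i l +
              \sum_(i < N.+1) \sum_(l < N | ~~ (i <= l)%N) t i l).
  by rewrite -big_split; apply: eq_bigr => i _; rewrite (bigID (fun l : 'I_N => (i <= l)%N)).
(* The last row of the first sum and the row [i = 0] of the second are empty. Without them both sums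
   run over [N] rows, and exchanging the indices of the second matches the cancelling terms. *)
rewrite big_ord_recr /= [X in _ + X + _]big1 ?addr0; last first.
  by move=> l; rewrite leqNgt ltn_ord.
rewrite [X in _ + X]big_ord_recl /= [X in _ + (X + _)]big1 ?add0r; last by [].
have -> : \sum_(i < N) \sum_(l < N | ~~ (bump 0 i <= l)%N) t (bump 0 i) l =
    \sum_(i < N) \sum_(l < N | (i <= l)%N) t l.+1 i.
  rewrite (exchange_big_dep xpredT)//=; apply: eq_bigr => i _.
  by apply: eq_bigl => l; rewrite /bump /= -leqNgt.
rewrite -big_split big1// => i _; rewrite -big_split big1// => l il /=.
rewrite /t nth_del_ge// nth_del_lt ?ltnS// del_del// Bsym.
by rewrite addSn addnC exprS mulN1r mulNr subrr.
Qed.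

End Multilinear.

(** * The exterior derivative in coordinates and its naturality *)

Section ExteriorDerivative.
Variable R : realType.

(** Induction on [s], for all [a] at once: expanding the first vector in the standard basis gives a
    sum of products of a coordinate with a multilinear function of the shorter list. *)
Lemma multilinear_product_rule n m p (a : 'rV[R]_m -> seq 'rV[R]_m -> R)
    (f : 'rV[R]_n -> 'rV[R]_m) (G : 'rV[R]_p -> 'rV[R]_n -> 'rV[R]_m) z0 v s :
  differentiable f z0 -> (forall w, differentiable (G w) z0) ->
  (\forall y \near f z0, multilinear_seq (a y)) ->
  (forall s, differentiable (a ^~ s) (f z0)) ->
  differentiable (fun z => a (f z) [seq G w z | w <- s]) z0 /\
  'D_v (fun z => a (f z) [seq G w z | w <- s]) z0 =
    'D_('D_v f z0) (a ^~ [seq G w z0 | w <- s]) (f z0) +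
    \sum_(l < size s) a (f z0)
       (take l [seq G w z0 | w <- s] ++ 'D_v (G (nth 0 s l)) z0 ::
        drop l.+1 [seq G w z0 | w <- s]).
Proof.
move=> df dG; elim: s a => [|w s ih] a ma da.
  split; first exact: (differentiable_comp df (da [::])).
  by rewrite big_ord0 addr0; exact: (derive_comp v df (da [::])).
pose A i y s := a y ('e_i :: s).
have mA i : \forall y \near f z0, multilinear_seq (A i y).
  by apply: filterS ma => y my s1 s2 c u u'; exact: (my ('e_i :: s1)).
have dA i t : differentiable (A i ^~ t) (f z0) by exact: da.
pose phi i z := A i (f z) [seq G w z | w <- s].
have {ih} ih i := ih (A i) (mA i) (dA i).
have dphi i : differentiable (phi i) z0 by case: (ih i).
have my0 := nbhs_singleton ma.
have expand y t u : multilinear_seq (a y) -> a y (u :: t) = \sum_i u 0 i * A i y t.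
  by move=> my; rewrite {1}(row_sum_delta u) (multilinear_seq_sum [::]).
pose g i z := (G w z) 0 i.
have dg i : differentiable (g i) z0.
  by move/differentiable_rowP: (dG w); exact.
have Dg i : 'D_v (g i) z0 = ('D_v (G w) z0) 0 i.
  by apply: derive_row_coord; exact: diff_derivable.
have E : \forall z \near z0, (\sum_i (g i * phi i)) z = a (f z) [seq G w z | w <- w :: s].
  have cf : \forall z \near z0, multilinear_seq (a (f z)).
    have cf : {for z0, continuous f} := differentiable_continuous df.
    exact: (cf _ ma).
  by apply: filterS cf => z mz; rewrite /= expand// fct_sumE.
have dgp i : differentiable (g i * phi i) z0 by exact: differentiableM.
split; first by apply: near_eq_differentiable E _; exact: differentiable_sum.
rewrite -(near_eq_derive v E) derive_sum; last first.
  by move=> i; exact/diff_derivable/dgp.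
set t := [seq G w z0 | w <- s].
(* In [D1] the derivative falls on the first vector, in [D2] on the coefficients of [a], in [D3] on
   a later vector. *)
pose D1 := \sum_i ('D_v (G w) z0) 0 i * A i (f z0) t.
pose D2 := \sum_i (G w z0) 0 i * 'D_('D_v f z0) (A i ^~ t) (f z0).
pose D3 := \sum_i (G w z0) 0 i * \sum_(l < size s) A i (f z0)
  (take l t ++ 'D_v (G (nth 0 s l)) z0 :: drop l.+1 t).
transitivity (D1 + D2 + D3).
  rewrite -!big_split; apply: eq_bigr => i _ /=.
  rewrite deriveM; [|exact: diff_derivable|exact: diff_derivable].
  rewrite Dg (ih i).2 -/t -addrA -mulrDr addrC.
  by congr (_ + _); exact: mulrC.
rewrite /= big_ord_recl /= drop0 (expand _ _ _ my0) -/D1 -addrA [RHS]addrCA.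
congr (_ + (_ + _)).
  have E2 : \forall y \near f z0, (\sum_i (cst ((G w z0) 0 i) * A i ^~ t)) y =
      a y (G w z0 :: t).
    by apply: filterS ma => y my; rewrite expand// fct_sumE.
  rewrite -(near_eq_derive _ E2) derive_sum; last first.
    move=> i; apply: derivableM; first exact: derivable_cst.
    exact/diff_derivable/dA.
  apply: eq_bigr => i _; rewrite deriveM; last 2 first.
  - exact: derivable_cst.
  - exact/diff_derivable/dA.
  by rewrite derive_cst scaler0 addr0.
transitivity (\sum_i \sum_(l < size s) (G w z0) 0 i * A i (f z0)
    (take l t ++ 'D_v (G (nth 0 s l)) z0 :: drop l.+1 t)).
  by apply: eq_bigr => i _; rewrite mulr_sumr.
by rewrite exchange_big; apply: eq_bigr => l _; rewrite /= (expand _ _ _ my0).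
Qed.

(** [extd al] at [x] is by definition [exd] of [in_chart al] in the chart at [x]. *)
Definition exd m (a : 'rV[R]_m -> seq 'rV[R]_m -> R) (y : 'rV[R]_m) (s : seq 'rV[R]_m) : R :=
  \sum_(i < size s) (-1) ^+ i *
    'D_(nth 0 s i) (fun y => a y (take i s ++ drop i.+1 s)) y.

(** By the product rule, differentiating the coefficients gives the right-hand side. Differentiating
    the vectors ['D_w f z] produces second derivatives of [f], which cancel by symmetry against
    alternation. *)
Lemma exd_pull n m (a : 'rV[R]_m -> seq 'rV[R]_m -> R)
    (f : 'rV[R]_n -> 'rV[R]_m) z0 s :
  diff2 f z0 -> (\forall y \near f z0, multilinear_seq (a y)) ->
  alternating_seq (a (f z0)) -> (forall s, differentiable (a ^~ s) (f z0)) ->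
  exd (fun z s => a (f z) [seq 'D_w f z | w <- s]) z0 s =
  exd a (f z0) [seq 'D_w f z0 | w <- s].
Proof.
move=> d2f ma aa da; have [df ddf] := d2f; have dfz := nbhs_singleton df.
rewrite /exd size_map.
have PR v s' := (multilinear_product_rule v s' dfz ddf ma da).2.
under eq_bigr => i _ do rewrite PR mulrDr.
rewrite big_split /=.
have := alternating_second_order 0 (fun w => 'D_w f z0) s (nbhs_singleton ma) aa
  (fun u w => diff2_sym w u d2f).
move=> ->; rewrite addr0; apply: eq_bigr => i _.
by rewrite (nth_map 0)// map_cat map_take map_drop.
Qed.

End ExteriorDerivative.

(** * Differentiability and pullbacks on manifolds *)

Lemma near_open (T : topologicalType) (U : set T) (x : T) :
  open U -> U x -> \forall y \near x, U y.
Proof. by move=> oU Ux; apply: open_nbhs_nbhs; split. Qed.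

Lemma near_cinv (R : realType) (M : topologicalType) (c : chart R M) x (P : set M) :
  cdom c x -> (\forall z \near x, P z) ->
  \forall y \near cmap c x, ctgt c y /\ P (cinv c y).
Proof.
move=> cx nP.
have ct : ctgt c (cmap c x) by exact: cmap_tgt.
have n1 : \forall y \near cmap c x, ctgt c y.
  exact: (near_open (@ctgt_open _ _ _) ct).
have ci := cinv_cont ct; rewrite /prop_for /continuous_at cmapK// in ci.
exact: (filterI n1 (ci _ nP)).
Qed.

Section Manifolds.
Variable R : realType.

Definition chart_expr (A B : manifold R) (f : A -> B) (x : A)
    (y : 'rV[R]_(cdim (chart_at x))) : 'rV[R]_(cdim (chart_at (f x))) :=
  cmap (chart_at (f x)) (f (cinv (chart_at x) y)).

(** Continuity is required separately: [chart_expr] does not see whether [f] leaves the chart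
    domain, outside which [cmap] is arbitrary. *)
Definition mdiff (A B : manifold R) (f : A -> B) (x : A) : Prop :=
  {for x, continuous f} /\
  differentiable (@chart_expr A B f x) (cmap (chart_at x) x).

(** [diff2] uses only the charts selected at [x]. The first clause concerns nearby points [z] in
    their own charts, to which [dif f] at [z] refers. *)
Definition mdiff2 (A B : manifold R) (f : A -> B) (x : A) : Prop :=
  (\forall z \near x, mdiff f z) /\
  diff2 (@chart_expr A B f x) (cmap (chart_at x) x).

Lemma mdiff2_mdiff (A B : manifold R) (f : A -> B) x : mdiff2 f x -> mdiff f x.
Proof. by move=> [/nbhs_singleton]. Qed.

Lemma near_cdom (A : manifold R) (x : A) :
  \forall z \near x, cdom (chart_at x) z.
Proof. exact: (near_open (@cdom_open _ _ _) (chart_at_dom x)). Qed.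

Lemma cmap_atK (A : manifold R) (x : A) :
  cinv (chart_at x) (cmap (chart_at x) x) = x.
Proof. exact/cmapK/chart_at_dom. Qed.

Lemma difE (A B : manifold R) (f : A -> B) x (v : tangent x) :
  dif f v = 'D_v (@chart_expr A B f x) (cmap (chart_at x) x).
Proof. by []. Qed.

Lemma dif_linear (A B : manifold R) (f : A -> B) x : mdiff f x ->
  forall (c : R) (u v : 'rV[R]_(cdim (chart_at x))),
    dif f (c *: u + v : tangent x) =
    c *: (dif f u : 'rV[R]_(cdim (chart_at (f x)))) + (dif f v : 'rV[R]_(cdim (chart_at (f x)))).
Proof. by move=> [_ df] c u v; rewrite !difE !deriveE// linearP. Qed.

Lemma chart_expr_comp_near (A B D : manifold R) (f : A -> B) (g : B -> D) x :
  {for x, continuous f} ->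
  \forall y \near cmap (chart_at x) x,
    (@chart_expr B D g (f x) \o @chart_expr A B f x) y =
    @chart_expr A D (g \o f) x y.
Proof.
move=> cf; have := near_cinv (chart_at_dom x) (cf _ (near_cdom (f x))).
apply: filterS => y [_ fy]; rewrite /chart_expr /=.
by rewrite (cmapK (fy : cdom (chart_at (f x)) _)).
Qed.

Lemma chart_expr_at (A B : manifold R) (f : A -> B) x :
  @chart_expr A B f x (cmap (chart_at x) x) = cmap (chart_at (f x)) (f x).
Proof. by rewrite /chart_expr cmap_atK. Qed.

Lemma mdiff_comp (A B D : manifold R) (f : A -> B) (g : B -> D) x :
  mdiff f x -> mdiff g (f x) -> mdiff (g \o f) x.
Proof.
move=> [cf df] [cg dg]; split; first exact: continuous_comp.
apply: near_eq_differentiable (chart_expr_comp_near g cf) _.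
by rewrite -chart_expr_at in dg; exact: (differentiable_comp df dg).
Qed.

Lemma dif_comp (A B D : manifold R) (f : A -> B) (g : B -> D) x (v : tangent x) :
  mdiff f x -> mdiff g (f x) -> dif (g \o f) v = dif g (dif f v).
Proof.
move=> [cf df] [cg dg].
rewrite 2!difE -(near_eq_derive v (chart_expr_comp_near g cf)).
by rewrite -chart_expr_at in dg *; exact: (derive_comp v df dg).
Qed.

Lemma pull_comp (A B D : manifold R) (f : A -> B) (g : B -> D) (al : rawform D)
    x (s : seq (tangent x)) :
  mdiff f x -> mdiff g (f x) -> pull (g \o f) al s = pull f (pull g al) s.
Proof.
move=> df dg; rewrite /pull -map_comp; congr (al _ _).
by apply: eq_map => v /=; exact: dif_comp.
Qed.

(** [dif] with the base point [b] of the target decoupled from [f x], so that it can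
    be rewritten along [f x = g x]. *)
Definition dif_to (A B : manifold R) (f : A -> B) (x : A) (b : B)
    (v : tangent x) : tangent b :=
  'D_v (fun y => cmap (chart_at b) (f (cinv (chart_at x) y))) (cmap (chart_at x) x).

Lemma near_chart_expr (A B : manifold R) (f g : A -> B) x b :
  (\forall z \near x, f z = g z) ->
  \forall y \near cmap (chart_at x) x,
    cmap (chart_at b) (f (cinv (chart_at x) y)) =
    cmap (chart_at b) (g (cinv (chart_at x) y)).
Proof.
move=> /(near_cinv (chart_at_dom x)).
by apply: filterS => y [_ /= ->].
Qed.

Lemma pull_near (A B : manifold R) (f g : A -> B) (al : rawform B) x
    (s : seq (tangent x)) :
  (\forall z \near x, f z = g z) -> pull f al s = pull g al s.
Proof.
move=> fg.
pose P b h := al b [seq @dif_to A B h x b v | v <- s].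
rewrite -[LHS]/(P (f x) f) -[RHS]/(P (g x) g) (nbhs_singleton fg) /P.
congr (al _ _); apply: eq_map => v; apply: near_eq_derive.
exact: near_chart_expr.
Qed.

Lemma mdiff2_comp (A B D : manifold R) (f : A -> B) (g : B -> D) x :
  mdiff2 f x -> mdiff2 g (f x) -> mdiff2 (g \o f) x.
Proof.
move=> [mf df] [mg dg]; have [cf _] := nbhs_singleton mf; split.
  by apply: filterS2 mf (cf _ mg) => z; exact: mdiff_comp.
apply: near_eq_diff2 (chart_expr_comp_near g cf) _.
by rewrite -chart_expr_at in dg; exact: (diff2_comp df dg).
Qed.

Lemma smooth_on_open (A B : manifold R) (U : set A) (f : A -> B)
    (a : chart R A) (b : chart R B) : open U -> smooth_on U f ->
  open [set y | [/\ ctgt a y, U (cinv a y) & cdom b (f (cinv a y))]].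
Proof.
move=> oU [cf _]; rewrite openE => y [ay Uy by_].
have n1 : \forall z \near y, ctgt a z.
  exact: (near_open (@ctgt_open _ _ _) ay).
have n2 : \forall z \near y, U (cinv a z).
  exact: (cinv_cont ay (near_open oU Uy)).
have n3 : \forall z \near y, cdom b (f (cinv a z)).
  exact: (cinv_cont ay (cf _ Uy _ (near_open (@cdom_open _ _ _) by_))).
by apply: filterS3 n1 n2 n3 => z.
Qed.

Lemma smooth_on_Cinf (A B : manifold R) (U : set A) (f : A -> B) x :
  open U -> smooth_on U f -> U x ->
  exists2 S : set 'rV[R]_(cdim (chart_at x)),
    open S /\ S (cmap (chart_at x) x) & Cinf S (@chart_expr A B f x).
Proof.
move=> oU sf Ux.
have := @smooth_on_open A B U f (chart_at x) (chart_at (f x)) oU sf.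
set S := (X in open X) => oS; exists S; last first.
  by case: sf => _; apply; exact: chart_at_atlas.
split=> //; split; rewrite ?cmap_atK//; last exact: chart_at_dom.
exact/cmap_tgt/chart_at_dom.
Qed.

Lemma smooth_on_mdiff (A B : manifold R) (U : set A) (f : A -> B) x :
  open U -> smooth_on U f -> U x -> mdiff f x.
Proof.
move=> oU sf Ux; split; first by case: sf => cf _; exact: cf.
have [S [oS Sx] CS] := smooth_on_Cinf oU sf Ux.
exact: Ck1_differentiable oS Sx (CS 1%N).
Qed.

Lemma smooth_on_mdiff2 (A B : manifold R) (U : set A) (f : A -> B) x :
  open U -> smooth_on U f -> U x -> mdiff2 f x.
Proof.
move=> oU sf Ux; split.
  apply: filterS (near_open oU Ux) => z.
  exact: smooth_on_mdiff.
have [S [oS Sx] CS] := smooth_on_Cinf oU sf Ux.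
exact: Ck2_diff2 oS Sx (CS 2%N).
Qed.

Lemma smooth_mdiff (A B : manifold R) (f : A -> B) x : smooth f -> mdiff f x.
Proof. by move=> sf; exact: (smooth_on_mdiff openT sf). Qed.

Lemma smooth_mdiff2 (A B : manifold R) (f : A -> B) x : smooth f -> mdiff2 f x.
Proof. by move=> sf; exact: (smooth_on_mdiff2 openT sf). Qed.

Lemma cinv_mdiff (A : manifold R) (c : chart R A) y : atlas A c -> ctgt c y ->
  @mdiff (euclid R (cdim c)) A (cinv c) y.
Proof.
move=> Ac cy; split; first exact: cinv_cont.
have Ck1 := atlas_compat Ac (chart_at_atlas (cinv c y)) 1%N.
apply: (Ck1_differentiable (@trans_open R A c (chart_at (cinv c y))) _ Ck1).
by split=> //; exact: chart_at_dom.
Qed.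

(** The chart of a Euclidean manifold is the identity, so [dcinv] is the differential of [cinv], and
    changes of coordinates become instances of [pull_comp]. *)
Lemma in_chartE (A : manifold R) (c : chart R A) (al : rawform A) :
  in_chart al = @pull R (euclid R (cdim c)) A (cinv c) al.
Proof. by []. Qed.

Lemma in_chart_multilinear (A : manifold R) j (al : rawform A) (c : chart R A) y :
  is_form j al -> atlas A c -> ctgt c y -> multilinear_seq (@in_chart R A c al y).
Proof.
move=> [_ ma _ _] Ac cy s1 s2 k u v; rewrite /in_chart !map_cat /=.
rewrite (_ : dcinv y (k *: u + v) = k *: (dcinv y u : 'rV_(_)) + (dcinv y v : 'rV_(_))).
  exact: ma.
exact: (dif_linear (cinv_mdiff Ac cy)).
Qed.

Lemma in_chart_alternating (A : manifold R) j (al : rawform A) (c : chart R A) y :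
  is_form j al -> alternating_seq (@in_chart R A c al y).
Proof.
by move=> [_ _ aa _] s1 s2 s3 u; rewrite /in_chart !(map_cat, map_cons) aa.
Qed.

Lemma in_chart_differentiable (A : manifold R) j (al : rawform A) (c : chart R A) y s :
  is_form j al -> atlas A c -> ctgt c y ->
  differentiable (fun y => @in_chart R A c al y s) y.
Proof.
move=> [_ _ _ sa] Ac cy.
exact: (Ck1_differentiable_scalar (@ctgt_open _ _ _) cy (sa c s Ac 1%N)).
Qed.

(** Near the point, [f \o cinv] equals the inverse chart at [f x] composed with [chart_expr];
    pulling [al] back along either composite gives the two sides. *)
Lemma in_chart_pull (A B : manifold R) (f : A -> B) (al : rawform B) x : mdiff2 f x ->
  \forall z \near cmap (chart_at x) x, forall s,
    @in_chart R A (chart_at x) (pull f al) z s =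
    @in_chart R B (chart_at (f x)) al (@chart_expr A B f x z)
      [seq 'D_w (@chart_expr A B f x) z | w <- s].
Proof.
move=> [mf [df _]]; have [cf _] := nbhs_singleton mf.
have n1 := near_cinv (chart_at_dom x) mf.
have n2 := near_cinv (chart_at_dom x) (cf _ (near_cdom (f x))).
have n3 : \forall z \near cmap (chart_at x) x,
    (f \o cinv (chart_at x)) z = (cinv (chart_at (f x)) \o @chart_expr A B f x) z.
  apply: filterS n2 => z [_ fz].
  by rewrite /= /chart_expr (cmapK (fz : cdom (chart_at (f x)) _)).
(* [pull_near] at [z] needs the equality on a neighbourhood of [z], not only at [z]. *)
have {}n3 := near_join n3.
apply: filterS3 (filterI n1 n2) n3 df => z [[cz mfz] [_ bz]] n3z dz s.
rewrite in_chartE -(@pull_comp (euclid R _) A B); last 2 first.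
- exact: (cinv_mdiff (chart_at_atlas x) cz).
- exact: mfz.
rewrite (@pull_near (euclid R _) B _ _ al z s n3z).
rewrite (@pull_comp (euclid R _) (euclid R _) B) //.
- by split=> //; exact: differentiable_continuous.
- by apply: cinv_mdiff; [exact: chart_at_atlas|exact: cmap_tgt].
Qed.

Lemma extd_pull (A B : manifold R) (f : A -> B) (al : rawform B) j x
    (s : seq (tangent x)) :
  mdiff2 f x -> is_form j al -> extd (pull f al) s = pull f (extd al) s.
Proof.
move=> mf fa.
transitivity (exd (fun z s => @in_chart R B (chart_at (f x)) al (@chart_expr A B f x z)
      [seq 'D_w (@chart_expr A B f x) z | w <- s]) (cmap (chart_at x) x) s).
  apply: eq_bigr => i _; congr (_ * _); apply: near_eq_derive.
  by apply: filterS (in_chart_pull al mf) => z; exact.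
have ct : ctgt (chart_at (f x)) (@chart_expr A B f x (cmap (chart_at x) x)).
  by rewrite chart_expr_at; exact/cmap_tgt/chart_at_dom.
rewrite exd_pull.
- by rewrite chart_expr_at.
- by case: mf.
- apply: filterS (near_open (@ctgt_open _ _ _) ct) => y cy.
  exact: (in_chart_multilinear fa (chart_at_atlas (f x)) cy).
- exact: (in_chart_alternating _ fa).
- move=> s'; exact: (in_chart_differentiable s' fa (chart_at_atlas (f x)) ct).
Qed.

End Manifolds.

(** * Slices of a product *)

Section RowPairs.
Variable R : realType.

Lemma row_mx0_linear m n : linear (fun v : 'rV[R]_m => row_mx v (0 : 'rV[R]_n)).
Proof. by move=> c u v; rewrite scale_row_mx add_row_mx scaler0 addr0. Qed.

Definition row_mx0 m n : {linear 'rV[R]_m -> 'rV[R]_(m + n)} :=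
  HB.pack (fun v : 'rV[R]_m => row_mx v (0 : 'rV[R]_n))
   (GRing.isLinear.Build R _ _ _ _ (@row_mx0_linear m n)).

Lemma row_0mx_linear m n : linear (fun v : 'rV[R]_n => row_mx (0 : 'rV[R]_m) v).
Proof. by move=> c u v; rewrite scale_row_mx add_row_mx scaler0 addr0. Qed.

Definition row_0mx m n : {linear 'rV[R]_n -> 'rV[R]_(m + n)} :=
  HB.pack (fun v : 'rV[R]_n => row_mx (0 : 'rV[R]_m) v)
   (GRing.isLinear.Build R _ _ _ _ (@row_0mx_linear m n)).

Lemma differentiable_linear n (W : normedModType R) (l : {linear 'rV[R]_n -> W}) x :
  differentiable l x.
Proof. by apply: linear_differentiable; exact: rV_linear_continuous. Qed.

Lemma derive_row_mx_cst m n (lam : 'rV[R]_n) (x v : 'rV[R]_m) :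
  differentiable (fun z : 'rV[R]_m => row_mx z lam) x /\
  'D_v (fun z : 'rV[R]_m => row_mx z lam) x = row_mx v 0.
Proof.
have -> : (fun z : 'rV[R]_m => row_mx z lam) =
    (@row_mx0 m n : 'rV[R]_m -> 'rV[R]_(m + n)) + cst (row_mx 0 lam).
  by apply/funext => z; rewrite fctE /= add_row_mx addr0 add0r.
have [d E1] := derive_linear (@row_mx0 m n) x v.
split; first exact: (differentiableD (differentiable_linear _ _)).
rewrite (deriveD d (derivable_cst _ _ _)) derive_cst addr0; exact: E1.
Qed.

(** Serves both the inverse of a product chart and [prod_map], whose coordinate expressions are the
    identity on the parameter block. *)
Lemma derive_row_mx_prod m n k (g : 'rV[R]_m -> 'rV[R]_k) (z w : 'rV[R]_(m + n)) :
  differentiable g (lsubmx z) ->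
  differentiable (fun z : 'rV[R]_(m + n) => row_mx (g (lsubmx z)) (rsubmx z)) z /\
  'D_w (fun z : 'rV[R]_(m + n) => row_mx (g (lsubmx z)) (rsubmx z)) z =
    row_mx ('D_(lsubmx w) g (lsubmx z)) (rsubmx w).
Proof.
move=> dg; pose f1 := (@row_mx0 k n \o g) \o (lsubmx : 'rV[R]_(m + n) -> 'rV[R]_m).
pose f2 := @row_0mx k n \o (rsubmx : 'rV[R]_(m + n) -> 'rV[R]_n).
have -> : (fun z : 'rV[R]_(m + n) => row_mx (g (lsubmx z)) (rsubmx z)) = f1 + f2.
  by apply/funext => y; rewrite fctE /f1 /f2 /= add_row_mx addr0 add0r.
have dl := differentiable_linear (lsubmx : {linear 'rV[R]_(m + n) -> 'rV[R]_m}) z.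
have dr := differentiable_linear (rsubmx : {linear 'rV[R]_(m + n) -> 'rV[R]_n}) z.
have d01 := differentiable_linear (@row_mx0 k n) (g (lsubmx z)).
have d02 := differentiable_linear (@row_0mx k n) (rsubmx z).
have d1 := differentiable_comp dg d01.
have df1 : differentiable f1 z := differentiable_comp dl d1.
have df2 : differentiable f2 z := differentiable_comp dr d02.
split; first exact: differentiableD.
rewrite deriveD; [|exact: diff_derivable|exact: diff_derivable].
rewrite /f1 /f2 (derive_comp w dl d1) (derive_comp _ dg d01) (derive_comp w dr d02).
rewrite (derive_linear _ z w).2
  (derive_linear (rsubmx : {linear 'rV[R]_(m + n) -> 'rV[R]_n}) z w).2.
by rewrite (derive_linear _ _ _).2 (derive_linear (@row_0mx k n) _ _).2 /= add_row_mx addr0 add0r.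
Qed.

End RowPairs.

Section Slices.
Variables (R : realType) (L : manifold R) (r : nat).
Let E := euclid R r.

Definition slice (lam : E) (y : L) : prodM L E := (y, lam).

Definition const_field (dir : 'rV[R]_r) : vfield (prodM L E) :=
  fun p => row_mx (0 : 'rV[R]_(cdim (chart_at p.1))) dir.

Lemma in_chart_at (A : manifold R) (al : rawform A) (x : A) s :
  @in_chart R A (chart_at x) al (cmap (chart_at x) x) s = al x s.
Proof.
(* Leaving the base point free lets [cinv (cmap x)] be rewritten to [x] although the tangent vectors
   depend on it. *)
pose P p := al p [seq 'D_w (fun z => cmap (chart_at p) (cinv (chart_at x) z))
   (cmap (chart_at x) x) | w <- s].
rewrite -[LHS]/(P (cinv (chart_at x) (cmap (chart_at x) x))) cmap_atK /P.
congr (al _ _); rewrite -[RHS]map_id; apply: eq_map => w.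
rewrite -[RHS](derive_id (cmap (chart_at x) x)); apply: near_eq_derive.
have ct : ctgt (chart_at x) (cmap (chart_at x) x) by exact/cmap_tgt/chart_at_dom.
by apply: filterS (near_open (@ctgt_open _ _ _) ct) => z cz; rewrite cinvK.
Qed.

Lemma slice_continuous lam : continuous (slice lam).
Proof. by move=> y; exact: (cvg_pair cvg_id (cvg_cst lam)). Qed.

Lemma near_slice_expr lam (y : L) :
  \forall z \near cmap (chart_at y) y, (row_mx z lam : 'rV[R]_(_ + r)) =
    @chart_expr R L (prodM L E) (slice lam) y z.
Proof.
have ct : ctgt (chart_at y) (cmap (chart_at y) y) by exact/cmap_tgt/chart_at_dom.
apply: filterS (near_open (@ctgt_open _ _ _) ct) => z cz.
by rewrite /chart_expr /= cinvK.
Qed.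

Lemma slice_mdiff lam y : mdiff (slice lam) y.
Proof.
split; first exact: slice_continuous.
apply: near_eq_differentiable (near_slice_expr lam y) _.
by case: (derive_row_mx_cst lam (cmap (chart_at y) y) 0).
Qed.

Lemma dif_slice lam (y : L) (v : tangent y) :
  dif (slice lam) v = row_mx (v : 'rV_(_)) 0.
Proof.
rewrite difE -(near_eq_derive v (near_slice_expr lam y)).
by case: (derive_row_mx_cst lam (cmap (chart_at y) y) v).
Qed.

Lemma dcinv_prod (c : chart R L) (z w : 'rV[R]_(cdim c + r)) :
  atlas L c -> ctgt c (lsubmx z) ->
  @dcinv R (prodM L E) (prod_chart c (@id_chart R r)) z w =
  row_mx (@dcinv R L c (lsubmx z) (lsubmx w)) (rsubmx w).
Proof.
move=> Ac cz; have [_ dc] := cinv_mdiff Ac cz.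
by case: (derive_row_mx_prod w dc).
Qed.

Lemma in_prod_chart (c : chart R L) (be : rawform (prodM L E)) lam x s :
  atlas L c -> ctgt c x ->
  @in_chart R (prodM L E) (prod_chart c (@id_chart R r)) be (row_mx x lam) s =
  be (cinv c x, lam)
    [seq row_mx (@dcinv R L c x (lsubmx w) : 'rV_(_)) (rsubmx w) | w <- s].
Proof.
move=> Ac cx.
pose P y l := be (cinv c y, l)
   [seq row_mx (@dcinv R L c y (lsubmx w) : 'rV_(_)) (rsubmx w) | w <- s].
transitivity (P (lsubmx (row_mx x lam)) (rsubmx (row_mx x lam))).
  congr (be _ _); apply: eq_map => w; apply: dcinv_prod => //.
  by rewrite row_mxKl.
by rewrite row_mxKl row_mxKr.
Qed.

Lemma in_chart_slice (c : chart R L) (be : rawform (prodM L E)) lam x s :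
  atlas L c -> ctgt c x ->
  @in_chart R L c (pull (slice lam) be) x s =
  @in_chart R (prodM L E) (prod_chart c (@id_chart R r)) be (row_mx x lam)
    [seq row_mx w 0 | w <- s].
Proof.
move=> Ac cx; rewrite in_prod_chart// /in_chart /pull.
congr (be _ _); rewrite -!map_comp; apply: eq_map => w /=.
by rewrite row_mxKl row_mxKr dif_slice.
Qed.

Lemma in_chart_slice_iprod (c : chart R L) (be : rawform (prodM L E)) lam dir x s :
  atlas L c -> ctgt c x ->
  @in_chart R L c (pull (slice lam) (iprod (const_field dir) be)) x s =
  @in_chart R (prodM L E) (prod_chart c (@id_chart R r)) be (row_mx x lam)
    (row_mx 0 dir :: [seq row_mx w 0 | w <- s]).
Proof.
move=> Ac cx; rewrite in_prod_chart// /in_chart /pull /iprod.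
congr (be _ _); rewrite /= row_mxKl row_mxKr; congr (_ :: _).
  by rewrite /const_field /dcinv derive0.
rewrite -!map_comp; apply: eq_map => w /=.
by rewrite row_mxKl row_mxKr dif_slice.
Qed.

Lemma derive_slice (W : normedModType R) m (B : 'rV[R]_(m + r) -> W) x v lam :
  'D_v (fun y => B (row_mx y lam)) x = 'D_(row_mx v 0) B (row_mx x lam).
Proof.
rewrite /derive; apply: (congr1 (fun F => lim (F @ 0^'))); apply/funext => h /=.
by rewrite scale_row_mx add_row_mx scaler0 add0r.
Qed.

(** Cartan's formula [L_v = d i_v + i_v d] for the constant field [v] on the second
    factor, restricted to a slice: its flow translates the slices. *)
Lemma derive_pull_slice (be : rawform (prodM L E)) (lam dir : 'rV[R]_r) y
    (s : seq (tangent y)) :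
  derive1 (fun t : R => pull (slice (lam + t *: dir)) be s) 0 =
  extd (pull (slice lam) (iprod (const_field dir) be)) s +
  pull (slice lam) (iprod (const_field dir) (extd be)) s.
Proof.
pose c := chart_at y; pose x := cmap c y.
pose B z S := @in_chart R (prodM L E) (prod_chart c (@id_chart R r)) be z S.
have Ac : atlas L c := chart_at_atlas y.
have cx : ctgt c x by exact/cmap_tgt/chart_at_dom.
pose s0 := [seq row_mx w (0 : 'rV[R]_r) | w : 'rV[R]_(cdim c) <- s].
(* In the product chart the vectors become constant and only the point moves, along a line in the
   parameter block. *)
have -> : (fun t : R => pull (slice (lam + t *: dir)) be s) =
    (fun t : R => B (t *: row_mx 0 dir + row_mx x lam) s0).
  apply/funext => t.
  rewrite -in_chart_at in_chart_slice// scale_row_mx add_row_mx scaler0 add0r.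
  by rewrite addrC.
rewrite -(derive_shiftE (B ^~ s0)).
have -> : pull (slice lam) (iprod (const_field dir) (extd be)) s =
    @extd R (prodM L E) be (y, lam) (row_mx 0 dir :: s0).
  rewrite /pull /iprod; congr (extd _ (_ :: _)).
  by apply: eq_map => w; rewrite dif_slice.
have -> : @extd R (prodM L E) be (y, lam) (row_mx 0 dir :: s0) =
    exd B (row_mx x lam) (row_mx 0 dir :: s0) by [].
(* The term of index 0 of [exd] differentiates along [dir] and is the left-hand side. The later
   terms keep [dir] as first argument; their shifted sign cancels them against the exterior
   derivative of the contraction. *)
rewrite /exd /= big_ord_recl /= expr0 mul1r drop0 size_map addrCA.
rewrite -[LHS]addr0; congr (_ + _); apply/esym.
rewrite /extd -big_split big1// => i _.
rewrite /bump /= add1n exprS mulN1r mulNr; apply/eqP; rewrite subr_eq0; apply/eqP.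
congr (_ * _).
rewrite add0n (nth_map (0 : 'rV_(cdim c)))//.
apply: (etrans _ (@derive_slice R^o _
  (B ^~ (row_mx 0 dir :: take i s0 ++ drop i.+1 s0)) x (nth 0 s i) lam)).
apply: near_eq_derive.
apply: filterS (near_open (@ctgt_open _ _ _) cx) => z cz.
by rewrite in_chart_slice_iprod// /B /s0 map_cat map_take map_drop.
Qed.

End Slices.

(** * Maps acting as the identity on the parameter *)

Section ProductMaps.
Variables (R : realType) (A B : manifold R) (r : nat) (f : A -> B).
Let E := euclid R r.

Definition prod_map (p : prodM A E) : prodM B E := (f p.1, p.2).

Lemma prod_map_mdiff (p : prodM A E) : mdiff f p.1 -> mdiff prod_map p.
Proof.
move=> [cf df]; split.
  have c1 : {for p, continuous (f \o fst)}.
    by apply: continuous_comp; [exact: cvg_fst|exact: cf].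
  exact: (cvg_pair c1 cvg_snd).
have dl : differentiable (@chart_expr R A B f p.1)
    (lsubmx (row_mx (cmap (chart_at p.1) p.1) (p.2 : 'rV[R]_r))).
  by rewrite row_mxKl.
by case: (derive_row_mx_prod 0 dl).
Qed.

Lemma dif_prod_map (p : prodM A E) (u : tangent p.1) (w : 'rV[R]_r) : mdiff f p.1 ->
  @dif R (prodM A E) (prodM B E) prod_map p (row_mx (u : 'rV_(_)) w) =
  row_mx (dif f u : 'rV_(_)) w.
Proof.
move=> [cf df].
have dl : differentiable (@chart_expr R A B f p.1)
    (lsubmx (row_mx (cmap (chart_at p.1) p.1) (p.2 : 'rV[R]_r))).
  by rewrite row_mxKl.
have [_] := derive_row_mx_prod (row_mx (u : 'rV_(_)) w) dl.
by rewrite !row_mxKl row_mxKr.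
Qed.

End ProductMaps.

(** * Lifting and descending differentiability *)

Section Lifts.
Variable R : realType.

Lemma cmap_cinv_continuous (A B : manifold R) (f : A -> B) x :
  {for x, continuous f} ->
  {for cmap (chart_at x) x, continuous (@chart_expr R A B f x)}.
Proof.
move=> cf; have ct : ctgt (chart_at x) (cmap (chart_at x) x).
  exact/cmap_tgt/chart_at_dom.
rewrite /chart_expr.
apply: (@continuous_comp _ _ _ (cinv (chart_at x))
  (fun z => cmap (chart_at (f x)) (f z))); first exact: cinv_cont.
rewrite cmap_atK; apply: continuous_comp; first exact: cf.
exact/cmap_cont/chart_at_dom.
Qed.

Lemma embedded_lift_continuous (A B D : manifold R) (i : B -> D) (f : A -> B) x :
  embedded i -> {for x, continuous (i \o f)} -> {for x, continuous f}.
Proof.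
move=> [_ ei] cif V; rewrite nbhsE => -[U [oU Ux] UV].
have [W oW UE] := ei U oU.
have nW : \forall y \near x, W (i (f y)).
  by apply: cif; apply: near_open => //; rewrite UE in Ux.
by apply: filterS nW => y Wy; apply: UV; rewrite UE.
Qed.

Lemma embedded_lift_mdiff (A B D : manifold R) (i : B -> D) (f : A -> B) x :
  embedded i -> mdiff (i \o f) x -> mdiff f x.
Proof.
move=> ei [cif dif_]; have cf := embedded_lift_continuous ei cif.
split=> //; have [[si _ di] _] := ei.
have [_ dix] := smooth_mdiff (f x) si.
rewrite -chart_expr_at in dix.
apply: (differentiable_immersion_lift dix _ dif_ (cmap_cinv_continuous cf)
  (chart_expr_comp_near i cf)).
move=> u v uv; apply: (di (f x)).
by rewrite !difE -(chart_expr_at f x) (deriveE u dix) (deriveE v dix).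
Qed.

Lemma submersion_chart (A B : manifold R) (p : A -> B) x :
  surjective_submersion p ->
  [/\ mdiff p x,
    forall w, exists v, 'd (@chart_expr R A B p x) (cmap (chart_at x) x) v = w &
    forall e : R, 0 < e -> exists2 r : R, 0 < r & forall y z,
      `|y - cmap (chart_at x) x| <= r -> `|z - cmap (chart_at x) x| <= r ->
      `|@chart_expr R A B p x y - @chart_expr R A B p x z -
        'd (@chart_expr R A B p x) (cmap (chart_at x) x) (y - z)| <= e * `|y - z|].
Proof.
move=> [sp _ dp]; have [cp dpx] := smooth_mdiff x sp; split=> // [w|].
  by have [v vw] := dp x w; exists v; rewrite -deriveE.
have [S [oS Sx] CS] := smooth_on_Cinf openT sp (I : setT x).
by have [] := Ck1_strict oS Sx (CS 1%N).
Qed.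

(** Needed for continuity of the descended map, which [mdiff] demands besides differentiability in
    charts. *)
Lemma submersion_open (A B : manifold R) (p : A -> B) x (U : set A) :
  surjective_submersion p -> nbhs x U -> \forall q \near p x, exists2 z, U z & p z = q.
Proof.
move=> sp nU; have [[cp _] + strict] := submersion_chart x sp.
move=> /surjective_linear_section[s ps].
have [d d0 surj] := local_surjection ps strict.
have [B0 B00 sB] := linear_bounded s.
have n1 : \forall z \near cmap (chart_at x) x,
    ctgt (chart_at x) z /\ (U `&` p @^-1` cdom (chart_at (p x))) (cinv (chart_at x) z).
  apply: (near_cinv (chart_at_dom x)).
  exact: filterI nU (cp _ (near_cdom (p x))).
have /nbhs_ballP[r /= r0 rP] := n1.
have ccm := cmap_cont (chart_at_dom (p x)).
(* The bound [d] allows solving for [w]; the other one keeps [s w], of norm at most [2 * B0] times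
   the distance, inside the ball of radius [r]. *)
have rd0 : 0 < Num.min d (r / (2 * B0)).
  by rewrite lt_min d0 divr_gt0// mulr_gt0.
have n2 : \forall q \near p x,
    `|cmap (chart_at (p x)) q - cmap (chart_at (p x)) (p x)| < Num.min d (r / (2 * B0)).
  by move/cvgrPdist_lt : ccm => /(_ _ rd0); apply: filterS => q; rewrite distrC.
apply: filterS2 n2 (near_cdom (p x)) => q; rewrite lt_min => /andP[qd qr] cq.
have [|w wq wE] := surj (cmap (chart_at (p x)) q).
  by rewrite chart_expr_at ltW.
rewrite chart_expr_at in wq.
have [|cz [Uz pz]] := rP (cmap (chart_at x) x + s w).
  rewrite -ball_normE /= opprD addNKr normrN (le_lt_trans (sB w))//.
  rewrite mulrC -ltr_pdivlMr//; apply: le_lt_trans wq _.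
  by rewrite mulrC -ltr_pdivlMr// -mulrA -invfM [B0 * 2]mulrC.
exists (cinv (chart_at x) (cmap (chart_at x) x + s w)) => //.
rewrite -[LHS](cmapK (pz : cdom (chart_at (p x)) _)) -[RHS](cmapK cq).
by rewrite -wE.
Qed.

Lemma submersion_descent_mdiff (A B D : manifold R) (p : A -> B) (b : B -> D) x :
  surjective_submersion p -> mdiff (b \o p) x -> mdiff b (p x).
Proof.
move=> sp [cbp dbp].
have [[cp dp] surj strict] := submersion_chart x sp.
split.
  move=> V /cbp nV; apply: filterS (submersion_open sp nV) => q [z Vz <-].
  exact: Vz.
rewrite -chart_expr_at.
exact: differentiable_submersion_descent dp surj strict dbp (chart_expr_comp_near b cp).
Qed.

(** Both sides are the pullback of [om] along [j = i' \o sg]: the lift [sg] is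
    differentiable because [i'] is an embedding, and [bar], induced by [sg], because
    [p] is a submersion. *)
Lemma pull_reduced (X L L' Q Q' : manifold R) (i' : L' -> X) (p : L -> Q)
    (p' : L' -> Q') (bar : Q -> Q') (j : L -> X) (om : rawform X) (red : rawform Q') :
  embedded i' -> surjective_submersion p -> surjective_submersion p' ->
  (forall y, mdiff j y) -> (forall y, exists y', i' y' = j y) ->
  (forall y y', i' y' = j y -> bar (p y) = p' y') ->
  pull p' red = pull i' om ->
  pull p (pull bar red) = pull j om.
Proof.
move=> ei sp sp' mj /choice[sg sgE] barE redE.
have jE : i' \o sg = j by apply/funext => y; exact: sgE.
have bE : bar \o p = p' \o sg by apply/funext => y; exact: barE.
have msg y : mdiff sg y by apply: embedded_lift_mdiff ei _; rewrite jE.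
have mi' y : mdiff i' y by apply: smooth_mdiff; case: ei => -[].
have mp y : mdiff p y by apply: smooth_mdiff; case: sp.
have mp' y : mdiff p' y by apply: smooth_mdiff; case: sp'.
have mbar y : mdiff bar (p y).
  by apply: submersion_descent_mdiff => //; rewrite bE; exact: mdiff_comp.
apply: functional_extensionality_dep => y; apply/funext => s.
by rewrite -pull_comp// bE pull_comp// redE -pull_comp// jE.
Qed.

End Lifts.

(** * Trivialized families *)

Section Rawforms.
Variable R : realType.

(** Holds without differentiability: a divergent limit is the junk value [0]. *)
Lemma derive_opp (V : normedModType R) (f : V -> R^o) x v :
  'D_v (fun y => - f y : R^o) x = - 'D_v f x.
Proof.
have [df|ndf] := pselect (derivable f x v); first exact: deriveN.
have ndNf : ~ derivable (- f) x v.
  by move=> /derivableN; rewrite opprK.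
rewrite /derive (dvgP (ndNf : ~ cvg _)) (dvgP (ndf : ~ cvg _)).
by rewrite (_ : point = 0 :> R^o)// oppr0.
Qed.

Lemma extd_fopp (M : manifold R) (al : rawform M) : extd (fopp al) = fopp (extd al).
Proof.
apply: functional_extensionality_dep => x; apply/funext => s.
rewrite /extd /fopp -sumrN; apply: eq_bigr => i _.
by rewrite -mulrN -derive_opp.
Qed.

Lemma foppK (M : manifold R) (al : rawform M) : fopp (fopp al) = al.
Proof.
by apply: functional_extensionality_dep => x; apply/funext => s; exact: opprK.
Qed.

Lemma near_eq_derive1 (f g : R -> R^o) t : (\forall u \near t, f u = g u) ->
  derive1 f t = derive1 g t.
Proof. by move=> fg; rewrite !derive1E; exact: near_eq_derive. Qed.

Lemma dif0 (A B : manifold R) (f : A -> B) x :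
  dif f (0 : 'rV_(cdim (chart_at x))) = (0 : 'rV_(cdim (chart_at (f x)))).
Proof. by rewrite difE derive0. Qed.

End Rawforms.

Lemma near_line (R : realType) n (C : set 'rV[R]_n) (lam dir : 'rV[R]_n) :
  open C -> C lam -> \forall t \near (0 : R), C (lam + t *: dir).
Proof.
move=> oC Clam.
have c0 : {for 0 : R, continuous (fun t : R => lam + t *: dir)}.
  apply: cvgD; first exact: cvg_cst.
  by apply: cvgZr_tmp; exact: cvg_id.
have nC : \forall z \near lam + 0 *: dir, C z.
  by apply: near_open => //; rewrite scale0r addr0.
exact: (c0 _ nC).
Qed.

Section Trivialized.
Variables (R : realType) (T : torus R) (X L : manifold R) (Th : trivialization T X L).
Variables (C : set 'rV[R]_(trank T)) (lam dir : 'rV[R]_(trank T)).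
Let E := euclid R (trank T).

Definition total_map : prodM L E -> X := fin Th \o ftriv Th.

Hypothesis oC : open C.
Hypothesis fin_smooth : smooth (fin Th).
Hypothesis ftriv_smooth : @smooth_on R (prodM L E) (fam Th) [set p | C p.2] (ftriv Th).

Lemma open_parameter : open [set p : prodM L E | C p.2].
Proof.
rewrite (_ : [set p | _] = snd @^-1` C)//.
by apply: open_comp => // p _; exact: cvg_snd.
Qed.

Lemma ftriv_mdiff2 (p : prodM L E) : C p.2 -> mdiff2 (ftriv Th) p.
Proof. exact: (smooth_on_mdiff2 open_parameter ftriv_smooth). Qed.

Lemma total_map_mdiff2 (p : prodM L E) : C p.2 -> mdiff2 total_map p.
Proof.
by move=> Cp; apply: mdiff2_comp; [exact: ftriv_mdiff2|exact: smooth_mdiff2].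
Qed.

Lemma total_slice_mdiff l y : C l -> mdiff (total_map \o slice l) y.
Proof.
move=> Cl; apply: mdiff_comp; first exact: slice_mdiff.
exact/mdiff2_mdiff/total_map_mdiff2.
Qed.

Variable psi : vfield (fam Th).
Hypothesis Clam : C lam.
Hypothesis base : forall y, ftriv Th (y, lam) = fbase Th y.
Hypothesis cpsi : constant_variation C dir psi.

(** [constant_variation] says that [ftriv Th] carries [const_field dir] to [psi], and [fbase Th] is
    the slice of [ftriv Th] at [lam]. *)
Lemma contraction_slice (om : rawform X) :
  pull (fbase Th) (iprod psi (pull (fin Th) om)) =
  pull (slice lam) (iprod (const_field dir) (pull total_map om)).
Proof.
have -> : fbase Th = ftriv Th \o slice lam by apply/funext => y; rewrite /= base.
apply: functional_extensionality_dep => y; apply/funext => s.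
have mt : mdiff (ftriv Th) (slice lam y) by exact/mdiff2_mdiff/ftriv_mdiff2.
rewrite pull_comp//; last exact: slice_mdiff.
pose S : seq (@tangent R (prodM L E) (slice lam y)) :=
  row_mx 0 dir :: [seq dif (slice lam) v | v <- s].
transitivity (@pull R (prodM L E) (fam Th) (ftriv Th) (pull (fin Th) om) (slice lam y) S).
  by rewrite /pull /iprod -(cpsi y Clam).
rewrite -pull_comp//.
exact: smooth_mdiff.
Qed.

Lemma derive_pull_level j (om : rawform X) y (s : seq (tangent y)) :
  is_form j om ->
  derive1 (fun t : R => pull (total_map \o slice (lam + t *: dir)) om s) 0 =
  extd (pull (fbase Th) (iprod psi (pull (fin Th) om))) s +
  pull (slice lam) (iprod (const_field dir) (pull total_map (extd om))) s.
Proof.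
move=> fom; rewrite contraction_slice.
(* Differentiability of [total_map] is known only over [C]; the derivative at 0 sees only those [t]
   for which the parameter stays in [C]. *)
have nC := near_line dir oC Clam.
transitivity (derive1 (fun t : R => pull (slice (lam + t *: dir)) (pull total_map om) s) 0).
  apply: near_eq_derive1; apply: filterS nC => t Ct.
  by rewrite pull_comp//; [exact: slice_mdiff|exact/mdiff2_mdiff/total_map_mdiff2].
rewrite derive_pull_slice; congr (_ + _).
rewrite /pull /iprod -/(pull _ _).
by apply: extd_pull fom; exact: total_map_mdiff2.
Qed.

Lemma pull_fderiv_level (Q : manifold R) (p : L -> Q) (w : R -> rawform Q) j
    (om : rawform X) y (s : seq (tangent y)) :
  is_form j om ->
  (\forall t \near (0 : R), pull p (w t) = pull (total_map \o slice (lam + t *: dir)) om) ->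
  pull p (fderiv w) s =
  extd (pull (fbase Th) (iprod psi (pull (fin Th) om))) s +
  pull (slice lam) (iprod (const_field dir) (pull total_map (extd om))) s.
Proof.
move=> fom wE; rewrite -(derive_pull_level s fom).
by apply: near_eq_derive1; apply: filterS wE => t /(congr1 (fun al => al y s)).
Qed.

End Trivialized.

(** * Levels over the family and the variation of the reduced form *)

Section Levels.
Variables (R : realType) (T : torus R) (M N : manifold R).
Implicit Types (th phi : trform T M N) (kappa : rform M N).

Lemma tdual_shift (lam dir : 'rV[R]_(trank T)) (t : R) xi :
  tdual (lam + t *: dir) xi = tdual lam xi + t * tdual dir xi.
Proof.
rewrite /tdual mulr_sumr -big_split; apply: eq_bigr => i _ /=.
by rewrite !mxE mulrDl mulrA.
Qed.

Lemma rform_eq (a b : rform M N) :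
  (forall y s, a.1 y s = b.1 y s) -> (forall x s, a.2 x s = b.2 x s) -> a = b.
Proof.
case: a b => [a1 a2] [b1 b2] /= e1 e2.
by congr pair; apply: functional_extensionality_dep => x; apply/funext => s.
Qed.

Lemma tscale0 phi psi : tadd phi (tscale 0 psi) = phi.
Proof.
by apply/funext => xi; apply: rform_eq => x s;
  rewrite /= /fadd /fscale mul0r addr0.
Qed.

(** The hypothesis says that [tdot lam kappa] vanishes. *)
Lemma level_shift phi kappa lam dir (t : R) :
  tadd (tdot lam kappa) phi = phi ->
  tadd phi (tscale t (tdot dir kappa)) = tadd (tdot (lam + t *: dir) kappa) phi.
Proof.
move=> H; apply/funext => xi; apply: rform_eq => x s.
  have := congr1 (fun th => (th xi).1 x s) H.
  by rewrite /= /fadd /fscale tdual_shift; lra.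
have := congr1 (fun th => (th xi).2 x s) H.
by rewrite /= /fadd /fscale tdual_shift; lra.
Qed.

End Levels.

(** The slice at [lam] lands in the level of parameter [lam] because [ftrivV] returns that
    parameter; it therefore lifts to [L'], as [pull_reduced] requires. *)
Lemma total_slice_reduced (R : realType) (T : torus R) (X L L' Q Q' : manifold R)
    (a : T -> X -> X) (i : L -> X) C lev base (Th : trivialization T X L)
    (lam : 'rV[R]_(trank T)) (i' : L' -> X) (p : L -> Q) (p' : L' -> Q')
    (bar : Q -> Q') (om : rawform X) (red : rawform Q') :
  open C -> is_trivialization a i C lev base Th -> C lam ->
  embedded i' -> range i' = lev lam ->
  surjective_submersion p -> surjective_submersion p' ->
  induced_on_quotients Th lam i' p p' bar ->
  pull p' red = pull i' om ->
  pull p (pull bar red) = pull (total_map Th \o slice lam) om.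
Proof.
move=> oC [[[sfin _ _] _ _] [sftriv _ _ _ trivK] levE _ _] Clam ei ri sp sp' ind redE.
apply: (pull_reduced ei sp sp' _ _ _ redE) => [y|y|y y'].
- exact: (total_slice_mdiff oC sfin sftriv).
- have : lev lam (fin Th (ftriv Th (y, lam))).
    by apply/(levE _ _ Clam); rewrite trivK.
  by rewrite -ri => -[y' _ y'E]; exists y'.
- exact: ind.
Qed.

Theorem lemma5p1 (R : realType) (T : torus R) (M N : manifold R) (F : M -> N)
    (aN : T -> N -> N) (aM : T -> M -> M) (k : nat) (varpi : rform M N)
    (mu phi : trform T M N) (kappa : rform M N)
    (C : set 'rV[R]_(trank T))
    (L : trform T M N -> level_pair M N)
    (red : forall th, rform (redM (L th)) (redN (L th)))
    (ThN : trivialization T N (lvN (L phi)))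
    (ThM : trivialization T M (lvM (L phi)))
    (barN : forall th, redN (L phi) -> redN (L th))
    (barM : forall th, redM (L phi) -> redM (L th))
    (psi : trform T M N) (dir : 'rV[R]_(trank T))
    (psiN : vfield (fam ThN)) (psiM : vfield (fam ThM)) :
  let P := level_family C kappa phi in
  let lev (lam : 'rV[R]_(trank T)) : trform T M N := tadd (tdot lam kappa) phi in
  (* the action on F : M -> N, the relative form and its moment map *)
  smooth F -> is_action aN -> is_action aM ->
  (forall g x, F (aM g x) = aN g (F x)) ->
  pre_plectic F k varpi -> rinvariant aN aM varpi ->
  moment_map F aN aM k varpi mu ->
  (* the level phi *)
  is_trform (k%:Z - 1) phi -> (forall xi, rinvariant aN aM (phi xi)) ->
  (forall xi, dF F (phi xi) = rzero) ->
  is_level_pair F aN aM mu phi (L phi) ->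
  (* the family of levels *)
  is_rform (k%:Z - 1) kappa -> rinvariant aN aM kappa -> dF F kappa = rzero ->
  open C ->
  (forall th, P th -> is_level_pair F aN aM mu th (L th)) ->
  (* the reduced forms *)
  (forall th, P th -> is_reduced k varpi (red th)) ->
  (* the trivialization of the family *)
  is_trivialization aN (inN (L phi)) C
    (fun lam => levelN mu (lev lam)) [set lam | lev lam = phi] ThN ->
  is_trivialization aM (inM (L phi)) C
    (fun lam => levelM F mu (lev lam)) [set lam | lev lam = phi] ThM ->
  (forall x lam, C lam ->
     F (fin ThM (ftriv ThM (x, lam))) = fin ThN (ftriv ThN (lvF (L phi) x, lam))) ->
  (* the identification of the reduced pairs with the one at phi *)
  (forall lam, C lam ->
     induced_on_quotients ThN lam (inN (L (lev lam)))
       (prN (L phi)) (prN (L (lev lam))) (barN (lev lam)) /\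
     induced_on_quotients ThM lam (inM (L (lev lam)))
       (prM (L phi)) (prM (L (lev lam))) (barM (lev lam))) ->
  (* the direction of variation *)
  (\forall t \near (0 : R), P (tadd phi (tscale t psi))) ->
  psi = tdot dir kappa ->
  constant_variation C dir psiN -> constant_variation C dir psiM ->
  let dvarpi : rform (redM (L phi)) (redN (L phi)) :=
    rderiv (fun t : R => let th := tadd phi (tscale t psi) in
      rpull (barN th) (barM th) (red th)) in
  let contr_omega : rawform (lvN (L phi)) :=
    pull (fbase ThN) (iprod psiN (pull (fin ThN) varpi.1)) in
  let contr_eta : rawform (lvM (L phi)) :=
    pull (fbase ThM) (iprod psiM (pull (fin ThM) varpi.2)) in
  [/\ rpull (prN (L phi)) (prM (L phi)) dvarpi =
        dF (lvF (L phi))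
          (rpull (fbase ThN) (fbase ThM)
             (riprod psiN psiM (rpull (fin ThN) (fin ThM) varpi))),
      pull (prN (L phi)) dvarpi.1 = extd contr_omega &
      pull (prM (L phi)) dvarpi.2 =
        fadd (pull (lvF (L phi)) contr_omega) (extd contr_eta)].
Proof.
move=> P lev sF _ _ _ [fvarpi dvarpi0] _ _ _ _ _ Lphi _ _ _ oC Llev redP.
move=> trN trM Fth ind nP psiE cN cM dvarpi contr_omega contr_eta.
(* The value [t = 0] of the variation shows that [phi] belongs to the family; its parameter [lam]
   may differ from 0. *)
have [lam Clam lamE] : exists2 lam, C lam & lev lam = phi.
  have [lam Clam E] := nbhs_singleton nP; exists lam => //.
  by rewrite /lev -E tscale0.
have levE (t : R) : tadd phi (tscale t psi) = lev (lam + t *: dir).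
  rewrite psiE; exact: level_shift.
have nC := near_line dir oC Clam.
have levP l : C l -> P (lev l) by exists l.
have [[eN rN eM rM] FL _ [qN qM] _] := Lphi.
have [[[sfinN _ _] _ _] [sftrivN _ _ _ _] _ _ baseN] := trN.
have [[[sfinM _ _] _ _] [sftrivM _ _ _ _] _ _ baseM] := trM.
have bN y : ftriv ThN (y, lam) = fbase ThN y by exact: baseN.
have bM y : ftriv ThM (y, lam) = fbase ThM y by exact: baseM.
have [fomega feta] := fvarpi.
have domega : extd varpi.1 = fzero := congr1 fst dvarpi0.
have deta : extd varpi.2 = pull F varpi.1.
  apply: functional_extensionality_dep => x; apply/funext => s.
  have := congr1 (fun al : rform M N => al.2 x s) dvarpi0.
  by rewrite /= /fadd /fopp /fzero => /eqP; rewrite subr_eq0 => /eqP.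
have wN : \forall t \near (0 : R),
    pull (prN (L phi)) (let th := tadd phi (tscale t psi) in
      rpull (barN th) (barM th) (red th)).1 =
    pull (total_map ThN \o slice (lam + t *: dir)) varpi.1.
  apply: filterS nC => t Ct; rewrite levE /=.
  have [[eN' rN' _ _] _ _ [[qN' _] _] _] := Llev _ (levP _ Ct).
  have [_ redE] := redP _ (levP _ Ct).
  apply: (total_slice_reduced oC trN Ct eN' rN' qN.1 qN' (ind _ Ct).1).
  exact: (congr1 fst redE).
have wM : \forall t \near (0 : R),
    pull (prM (L phi)) (let th := tadd phi (tscale t psi) in
      rpull (barN th) (barM th) (red th)).2 =
    pull (total_map ThM \o slice (lam + t *: dir)) varpi.2.
  apply: filterS nC => t Ct; rewrite levE /=.
  have [[_ _ eM' rM'] _ _ [_ [qM' _]] _] := Llev _ (levP _ Ct).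
  have [_ redE] := redP _ (levP _ Ct).
  apply: (total_slice_reduced oC trM Ct eM' rM' qM.1 qM' (ind _ Ct).2).
  exact: (congr1 snd redE).
have EN : pull (prN (L phi)) dvarpi.1 = extd contr_omega.
  apply: functional_extensionality_dep => y; apply/funext => s.
  rewrite (pull_fderiv_level oC sfinN sftrivN Clam bN cN s fomega wN).
  by rewrite domega addr0.
have EM : pull (prM (L phi)) dvarpi.2 =
    fadd (pull (lvF (L phi)) contr_omega) (extd contr_eta).
  apply: functional_extensionality_dep => x; apply/funext => s.
  rewrite (pull_fderiv_level oC sfinM sftrivM Clam bM cM s feta wM) addrC.
  congr (_ + _); rewrite deta /contr_omega.
  rewrite (contraction_slice oC sfinN sftrivN Clam bN cN).
  (* [lvF] is the lift of [F \o inM] through the embedding [inN]. *)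
  have mL y : mdiff (lvF (L phi)) y.
    apply: embedded_lift_mdiff eN _.
    rewrite (_ : _ \o _ = F \o inM (L phi)); last by apply/funext => z; exact: FL.
    by apply: mdiff_comp; apply: smooth_mdiff => //; case: eM => -[].
  pose S : seq (@tangent R (prodM (lvM (L phi)) (euclid R (trank T))) (slice lam x)) :=
    row_mx 0 dir :: [seq dif (slice lam) v | v <- s].
  have mM : mdiff (total_map ThM) (slice lam x).
    exact: (mdiff2_mdiff (@total_map_mdiff2 _ _ _ _ ThM C oC sfinM sftrivM (x, lam) Clam)).
  have mN z : mdiff (total_map ThN) (slice lam z).
    exact: (mdiff2_mdiff (@total_map_mdiff2 _ _ _ _ ThN C oC sfinN sftrivN (z, lam) Clam)).
  transitivity (pull (total_map ThM) (pull F varpi.1) S); first by [].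
  rewrite -pull_comp//; last exact: smooth_mdiff.
  (* [F] intertwines the trivializations over [C], hence near the slice point, which is enough for
     pullbacks there. *)
  rewrite (@pull_near _ _ _ _ (total_map ThN \o prod_map (lvF (L phi)))); last first.
    apply: filterS (near_open (open_parameter oC) (Clam : C (slice lam x).2)) => -[z l] Cl.
    exact: Fth.
  rewrite pull_comp//; [|exact: prod_map_mdiff|exact: mN].
  (* The differential of [prod_map] fixes the vector [row_mx 0 dir], so the contraction direction on
     [M] goes to the one on [N]. *)
  rewrite {1}/pull /= dif_prod_map// dif0.
  rewrite /pull /iprod /=; congr (varpi.1 _ (_ :: _)).
  rewrite -!map_comp; apply: eq_map => v /=.
  by rewrite !dif_slice dif_prod_map.
split=> //.
rewrite /dF /rpull /= EN EM; congr pair; congr fadd.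
(* The sign of [riprod] on the second component cancels the one of [dF]. *)
by rewrite -extd_fopp; congr extd; exact/esym/foppK.
Qed.
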